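(* Assume that the operator $L$ with the Dirichlet boundary condition is self-adjoint, and let $\nu$ be a probability measure on $D$. Assume either that $\nu$ possesses an $L^2(D,d\mu_{\mathrm{rev}})$-density, or that the Fourier series $\sum_{n=0}^\infty\frac{F_n}{\lambda_n^D}\phi_n^D(x)$ converges uniformly and absolutely. Assume also that the jump measure $\nu$ satisfies one of the following two conditions: (i) $F_nG_n(\nu)\ge0$ for all $n\ge1$, or $F_nG_n(\nu)\le0$ for all $n\ge1$; (ii) $F_nG_n(\nu)\ne0$ for at most two values of $n$. Then all the eigenvalues of $\mathcal{L}$ are real.
   Context: Setting: $D\subset\mathbb{R}^d$ is a bounded domain and $L=\frac12\nabla\cdot a\nabla+b\cdot\nabla$ is a second-order elliptic operator on $D$, where $a=\{a_{ij}\}_{i,j=1}^d$ is positive definite with entries in $C^{2,\alpha}(\mathbb{R}^d)$ and $b=(b_1,\dots,b_d)$ has entries in $C^{1,\alpha}(\mathbb{R}^d)$, for some $\alpha\in(0,1]$. Either $D$ has a $C^{2,\alpha}$-boundary, or $D=D_1\times\cdots\times D_k$ and $L=\sum_{i=1}^k L_i$, where $L_i$ is defined on $D_i$ and $D_i$ has a $C^{2,\alpha}$-boundary. The operator $\mathcal{L}$: for a probability measure $\nu$ on $D$ (the jump measure), $\mathcal{L}f=Lf$ on the domain $\{f\in C^2(\overline D): \int_D f\,d\nu=f|_{\partial D}\}$ (so $f$ is constant on $\partial D$, equal there to $\int_D f\,d\nu$; complex-valued functions allowed). A number $\lambda\in\mathbb{C}$ is an eigenvalue of $\mathcal{L}$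 if there is a nonzero $f$ in this domain with $Lf=\lambda f$ in $D$. Self-adjoint case: ''$L$ with the Dirichlet boundary condition is self-adjoint'' means that $b=a\nabla Q$ for some function $Q$, so that $L=\frac12\exp(-2Q)\nabla\cdot a\exp(2Q)\nabla$; $Q$ is normalized by an additive constant so that $\int_D\exp(2Q)\,dx=1$, and $\mu_{\mathrm{rev}}$ denotes the probability measure $\exp(2Q)\,dx$ on $D$. $L$ with the Dirichlet boundary condition is then self-adjoint on $L^2(D,\mu_{\mathrm{rev}})$ (on an appropriate domain). Its eigenvalues are real and negative and are denoted $\{\lambda_n^D\}_{n=0}^\infty$, labeled in nonincreasing order and repeated according to multiplicity; $\{\phi_n^D\}_{n=0}^\infty$ is a corresponding orthonormal basis of $L^2(D,\mu_{\mathrm{rev}})$ of real eigenfunctions, with $\int_D(\phi_n^D)^2\,d\mu_{\mathrm{rev}}=1$ and $\phi_0^D>0$. Set $$F_n\equiv\int_D\phi_n^D\,d\mu_{\mathrm{rev}},\qquad G_n(\nu)\equiv\int_D\phi_n^D\,d\nu,\qquad n\ge0.$$ *)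

(* Defs.v *)
From HB Require Import structures.
From mathcomp Require Import all_boot all_order all_algebra.
From mathcomp Require Import all_classical all_reals all_analysis.
From mathcomp Require Import measurable_realfun lra.
From mathcomp.real_closed Require Import complex.
Set Implicit Arguments.
Unset Strict Implicit.
Unset Printing Implicit Defensive.
Import Order.TTheory GRing.Theory Num.Theory.
Import numFieldNormedType.Exports.
Local Open Scope classical_set_scope.
Local Open Scope ring_scope.

(* 'rV[R]_n with its Borel sigma-algebra. *)
Notation euc R n := (g_sigma_algebraType (@open 'rV[R]_n)).

Section LebesgueMeasure.
Context (R : realType).
Local Notation Rm := (measurableTypeR R).

Definition rv_cons n (p : Rm * euc R n) : euc R n.+1 :=
  row_mx (p.1%:M : 'rV[R]_1) (p.2 : 'rV[R]_n) : 'rV[R]_(1 + n).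

Definition rv_uncons n (x : euc R n.+1) : Rm * euc R n :=
  ((lsubmx (x : 'rV[R]_(1 + n)) : 'rV[R]_1) 0 0, rsubmx (x : 'rV[R]_(1 + n))).

Lemma rv_consK n : cancel (@rv_cons n) (@rv_uncons n).
Proof.
move=> [t y]; rewrite /rv_uncons /rv_cons /=.
by rewrite row_mxKl row_mxKr mxE eqxx mulr1n.
Qed.

Lemma measurable_rv_uncons n : measurable_fun setT (@rv_uncons n).
Proof.
apply/measurable_fun_pairP; split.
  apply: (@measurability _ _ _ (measurableTypeR R) _ _ _ (RGenOpens.measurableE R)).
  move=> _ [_ [a [b ->] <-]]; rewrite setTI; apply: sub_sigma_algebra.
  have /continuousP cf : continuous
      ((fun M : 'rV[R]_1 => M 0 0) \o (lsubmx : 'rV[R]_(1 + n) -> 'rV[R]_1)).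
    move=> x; apply: continuous_comp; first exact: continuous_lsubmx.
    exact: coord_continuous.
  exact/cf/interval_open.
apply: (@measurability _ _ _ (euc R n) _ _ (@open 'rV[R]_n) erefl).
move=> _ [A oA <-]; rewrite setTI; apply: sub_sigma_algebra.
have /continuousP cf : continuous (rsubmx : 'rV[R]_(1 + n) -> 'rV[R]_n).
  exact: continuous_rsubmx.
exact: cf.
Qed.

Lemma measurable_rv_cons n : measurable_fun setT (@rv_cons n).
Proof.
apply: (@measurability _ _ _ (euc R n.+1) _ _ (@open 'rV[R]_n.+1) erefl).
move=> _ [A oA <-]; rewrite setTI.
pose I (q : rat * rat) := `]ratr q.1 : R, ratr q.2[%classic.
pose W q : set 'rV[R]_n :=
  interior [set y | forall t, I q t -> A (rv_cons (t, y))].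
rewrite (_ : _ @^-1` A = \bigcup_(q in setT) (I q `*` W q)); last first.
  apply/seteqP; split => [[t y] /= Aty|[t y] [q _ [/= It Wy]]]; last first.
    exact: (interior_subset Wy).
  have := open_nbhs_nbhs (conj oA Aty) => /nbhs_ballP[e /= e0 eA].
  have /rat_in_itvoo[q1 q1t] : t - e < t by rewrite gtrBl.
  have /rat_in_itvoo[q2 q2t] : t < t + e by rewrite ltrDl.
  exists (q1, q2) => //; split => /=.
    by rewrite /I /= in_itv /= (itvP q1t) (itvP q2t).
  apply/nbhs_ballP; exists e => //= z [_ yz] s.
  rewrite /I /= in_itv /= => /andP[q1s q2s]; apply: eA; split => // i j.
  suff : ball (row_mx (t%:M : 'rV[R]_1) (y : 'rV[R]_n) 0 j : R) e
      (row_mx (s%:M : 'rV[R]_1) (z : 'rV[R]_n) 0 j : R) by rewrite !ord1.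
  case: (@split_ordP 1 n j) => k ->; last by rewrite !row_mxEr; exact: yz.
  rewrite !row_mxEl !mxE ord1 !eqxx !mulr1n /ball/= ltr_norml.
  have /andP[h1 _] : t - e < ratr q1 < t by move: q1t; rewrite in_itv.
  have /andP[_ h2] : t < ratr q2 < t + e by move: q2t; rewrite in_itv.
  by apply/andP; split; lra.
apply: countable_bigcupT_measurable => // q; apply: measurableX.
  exact: measurable_itv.
by apply: sub_sigma_algebra; exact: open_interior.
Qed.

Section step.
Variables (n : nat) (m : {sigma_finite_measure set (euc R n) -> \bar R}).

Definition leb_step : set (euc R n.+1) -> \bar R :=
  pushforward (@lebesgue_measure R \x m)%E (@rv_cons n).

Let leb_step0 : leb_step set0 = 0%E.
Proof. by rewrite /leb_step /pushforward preimage_set0 measure0. Qed.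

Let leb_step_ge0 A : (0 <= leb_step A)%E.
Proof. by rewrite /leb_step /pushforward integral_ge0. Qed.

Let leb_step_sigma_additive : semi_sigma_additive leb_step.
Proof.
have mc A : measurable A -> measurable (@rv_cons n @^-1` A).
  by move=> mA; rewrite -[X in measurable X]setTI; exact: measurable_rv_cons.
move=> F mF tF mUF; rewrite /leb_step /pushforward preimage_bigcup.
apply: (@measure_semi_sigma_additive _ _ _ (@lebesgue_measure R \x m)%E).
- by move=> k; exact: mc.
- apply/trivIsetP => /= i j _ _ ij; rewrite -preimage_setI.
  by move/trivIsetP : tF => /(_ _ _ _ _ ij) ->//; rewrite preimage_set0.
- by rewrite -preimage_bigcup; exact: mc.
Qed.

HB.instance Definition _ := isMeasure.Build _ _ _ leb_step
  leb_step0 leb_step_ge0 leb_step_sigma_additive.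

Let leb_step_sigma_finite : sigma_finite setT leb_step.
Proof.
have /sigma_finiteP[F [TF ndF Foo]] := sigma_finiteT (@lebesgue_measure R).
have /sigma_finiteP[G [TG ndG Goo]] := sigma_finiteT m.
exists (fun k => @rv_uncons n @^-1` (F k `*` G k)).
  rewrite -preimage_bigcup; apply/esym; rewrite -subTset => x _ /=.
  have [k _ Fk] : (\bigcup_k F k) (rv_uncons x).1 by rewrite -TF.
  have [l _ Gl] : (\bigcup_k G k) (rv_uncons x).2 by rewrite -TG.
  exists (maxn k l) => //; split.
  - by move: Fk; exact/subsetPset/ndF/leq_maxl.
  - by move: Gl; exact/subsetPset/ndG/leq_maxr.
move=> k; have [mF Fk] := Foo k; have [mG Gk] := Goo k; split.
  rewrite -[X in measurable X]setTI; apply: measurable_rv_uncons => //.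
  exact: measurableX.
rewrite /leb_step /pushforward (_ : _ @^-1` _ = F k `*` G k); last first.
  by apply/funext => p; rewrite /preimage /mkset rv_consK.
by rewrite product_measure1E// lte_mul_pinfty// ge0_fin_numE.
Qed.

HB.instance Definition _ := Measure_isSigmaFinite.Build _ _ _ leb_step
  leb_step_sigma_finite.
End step.

(* Lebesgue measure on R^n: the product of 1-dimensional Lebesgue measure with
   Lebesgue measure on R^(n-1), transported by rv_cons. *)
Fixpoint leb n : {sigma_finite_measure set (euc R n) -> \bar R} :=
  match n with
  | 0 => @dirac _ (euc R 0) (0 : 'rV[R]_0) R
  | n'.+1 => leb_step (leb n')
  end.
End LebesgueMeasure.

Section Regularity.
Context (R : realType).

Definition partial n (i : 'I_n) (f : 'rV[R]_n -> R) : 'rV[R]_n -> R :=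
  'D_(delta_mx 0 i) f.

Definition boundary n (D : set 'rV[R]_n) : set 'rV[R]_n :=
  closure D `\` D°.

Definition locally_hoelder n (alpha : R) (f : 'rV[R]_n -> R) : Prop :=
  forall r : R, exists C : R, forall x y : 'rV[R]_n, `|x| <= r -> `|y| <= r ->
    `|f x - f y| <= C * `|x - y| `^ alpha.

(* C^{k,alpha}(R^n): the partial derivatives of order k are alpha-Hoelder on
   bounded sets. *)
Fixpoint C_hoelder n (k : nat) (alpha : R) (f : 'rV[R]_n -> R) : Prop :=
  match k with
  | 0 => locally_hoelder alpha f
  | k'.+1 => continuous f /\ forall i : 'I_n,
      (forall x, derivable f x (delta_mx 0 i)) /\
      C_hoelder k' alpha (partial i f)
  end.

Fixpoint C_extends n (k : nat) (D : set 'rV[R]_n) (f : 'rV[R]_n -> R) : Prop :=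
  (exists g : 'rV[R]_n -> R,
     {within closure D, continuous g} /\ forall x, D x -> g x = f x) /\
  match k with
  | 0 => True
  | k'.+1 => forall i : 'I_n,
      (forall x, D x -> derivable f x (delta_mx 0 i)) /\
      C_extends k' D (partial i f)
  end.

(* C^k of the closure of the open set D: f is continuous on the closure, and its
   derivatives of order at most k exist in D and extend continuously to the
   closure. *)
Definition C_closure n (k : nat) (D : set 'rV[R]_n) (f : 'rV[R]_n -> R) : Prop :=
  {within closure D, continuous f} /\ C_extends k D f.

Definition bounded_domain n (D : set 'rV[R]_n) : Prop :=
  [/\ open D, connected D, D !=set0 & bounded_set D].

(* Near each boundary point, up to relabelling and reorienting the coordinates,
   D is the region above the graph of a C^{2,alpha} function of the other
   coordinates. *)
Definition C2_boundary n (alpha : R) (D : set 'rV[R]_n.+1) : Prop :=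
  forall x0, boundary D x0 ->
    exists r : R, exists i : 'I_n.+1, exists s : bool,
    exists gamma : 'rV[R]_n -> R,
    [/\ 0 < r, C_hoelder 2 alpha gamma &
        forall x, ball x0 r x ->
          (D x <-> 0 < (-1) ^+ s * (x 0 i - gamma (col' i x)))].

End Regularity.

Section Operator.
Context (R : realType) (n : nat).
Implicit Types (a : 'rV[R]_n -> 'M[R]_n) (b : 'rV[R]_n -> 'rV[R]_n)
  (D : set 'rV[R]_n) (Q f : 'rV[R]_n -> R).

Definition positive_definite (A : 'M[R]_n) : Prop :=
  A^T = A /\ forall v : 'rV[R]_n, v != 0 -> 0 < (v *m A *m v^T) 0 0.

Definition elliptic_coefficients (alpha : R) a b : Prop :=
  [/\ forall x, positive_definite (a x),
      forall i j, C_hoelder 2 alpha (fun x => a x i j) &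
      forall i, C_hoelder 1 alpha (fun x => b x 0 i)].

(* L = 1/2 div (a grad) + b . grad *)
Definition opL a b f (x : 'rV[R]_n) : R :=
  2^-1 * (\sum_i partial i (fun y => \sum_j a y i j * partial j f y) x) +
  \sum_i b x 0 i * partial i f x.

(* b = a grad Q in D *)
Definition drift_potential D a b Q : Prop :=
  forall x, D x ->
    differentiable Q x /\ forall i, b x 0 i = \sum_j a x i j * partial j Q x.

(* mu is exp(2Q)dx on D; that mu is a probability normalizes Q. *)
Definition reversible_measure D Q (mu : probability (euc R n) R) : Prop :=
  forall A : set (euc R n), measurable A ->
    mu A = (\int[leb R n]_(x in A `&` D) (expR (2 * Q x))%:E)%E.

Definition square_integrable D (mu : probability (euc R n) R) f : Prop :=
  measurable_fun (D : set (euc R n)) f /\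
  (\int[mu]_(x in D) ((f x) ^+ 2)%:E < +oo)%E.

Definition L2_density D (mu nu : probability (euc R n) R) : Prop :=
  exists h : 'rV[R]_n -> R,
    [/\ square_integrable D mu h, forall x, D x -> 0 <= h x &
        forall A : set (euc R n), measurable A ->
          nu A = (\int[mu]_(x in A `&` D) (h x)%:E)%E].

Definition inner D (mu : probability (euc R n) R) f g : R :=
  (\int[mu]_(x in D) (f x * g x))%R.

(* Completeness makes lam list every Dirichlet eigenvalue with its
   multiplicity. *)
Definition dirichlet_eigenbasis a b D (mu : probability (euc R n) R)
    (lam : nat -> R) (phi : nat -> 'rV[R]_n -> R) : Prop :=
  [/\ forall k, [/\ C_closure 2 D (phi k), forall x, boundary D x -> phi k x = 0 &
        forall x, D x -> opL a b (phi k) x = lam k * phi k x],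
      nonincreasing_seq lam,
      forall j k, inner D mu (phi j) (phi k) = (j == k)%:R,
      forall h, square_integrable D mu h ->
        (fun N => \int[mu]_(x in D)
          ((h x - \sum_(0 <= k < N) inner D mu h (phi k) * phi k x) ^+ 2)%:E)%E
        @ \oo --> 0%E &
      forall x, D x -> 0 < phi 0 x].

Definition opLC a b (f : 'rV[R]_n -> R[i]) (x : 'rV[R]_n) : R[i] :=
  (opL a b (fun y => complex.Re (f y)) x +i* opL a b (fun y => complex.Im (f y)) x)%C.

Definition meanC D (nu : probability (euc R n) R) (f : 'rV[R]_n -> R[i]) : R[i] :=
  ((\int[nu]_(x in D) complex.Re (f x))%R +i*
   (\int[nu]_(x in D) complex.Im (f x))%R)%C.

Definition jump_domain D (nu : probability (euc R n) R) (f : 'rV[R]_n -> R[i]) : Prop :=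
  [/\ C_closure 2 D (fun x => complex.Re (f x)),
      C_closure 2 D (fun x => complex.Im (f x)) &
      forall x, boundary D x -> f x = meanC D nu f].

Definition jump_eigenvalue a b D (nu : probability (euc R n) R) (z : R[i]) : Prop :=
  exists f : 'rV[R]_n -> R[i],
    [/\ jump_domain D nu f, exists2 x, closure D x & f x != 0 &
        forall x, D x -> opLC a b f x = z * f x].

End Operator.

(* D = D_1 x ... x D_k and L = L_1 + ... + L_k; part x i is the component of x
   in the i-th factor, of dimension (m i).+1. *)
Definition product_structure (R : realType) (n : nat) (alpha : R)
    (D : set 'rV[R]_n.+1) (a : 'rV[R]_n.+1 -> 'M[R]_n.+1)
    (b : 'rV[R]_n.+1 -> 'rV[R]_n.+1) : Prop :=
  exists (k : nat) (m : 'I_k -> nat) (e : n.+1 = (\sum_(i < k) (m i).+1)%N),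
  let part (x : 'rV[R]_n.+1) (i : 'I_k) : 'rV[R]_(m i).+1 :=
    submxrow (castmx (erefl 1%N, e) x) i in
  exists (Di : forall i, set 'rV[R]_(m i).+1)
         (ai : forall i, 'rV[R]_(m i).+1 -> 'M[R]_((m i).+1))
         (bi : forall i, 'rV[R]_(m i).+1 -> 'rV[R]_(m i).+1),
  [/\ forall i, bounded_domain (Di i) /\ C2_boundary alpha (Di i),
      forall x, D x <-> forall i, Di i (part x i) &
      forall x, D x ->
        castmx (e, e) (a x) = \mxdiag_(i < k) ai i (part x i) /\
        castmx (erefl 1%N, e) (b x) = \mxrow_(i < k) bi i (part x i)].

(* Main.v *)
Require Import Defs.
From mathcomp Require Import all_boot all_order all_algebra.
From mathcomp Require Import all_classical all_reals all_analysis.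
From mathcomp Require Import measurable_realfun ring lra.
From mathcomp.real_closed Require Import complex.
Set Implicit Arguments.
Unset Strict Implicit.
Unset Printing Implicit Defensive.
Import Order.TTheory GRing.Theory Num.Theory.
Import numFieldNormedType.Exports.
Local Open Scope classical_set_scope.
Local Open Scope ring_scope.

(** Let [f] be an eigenfunction of the jump operator for a non-real [z], let [c] be
    its boundary value, and write [f = c + g], so that [g] vanishes on the
    boundary, [L g = z g + z c] and the integral of [g] against [nu] is zero.
    Symmetry of [L] on functions vanishing on the boundary ([opL_symmetric])
    gives the Fourier coefficients of [g]:
      [(lam k - z) (g, phi k) = z c F k].
    If [c = 0] they all vanish, hence [g = 0] by completeness and [f = 0]. If
    [c <> 0], integrating the Fourier series of [g] against [nu] gives
      [sum_k F k G k / (lam k - z) = 0].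
    Taking real and imaginary parts, both [sum_k t k] and
    [sum_k t k (lam 0 - lam k)] vanish, where [t k = F k G k / |lam k - z|^2]. If
    the [t k] with [k >= 1] have one sign, the second sum forces them to vanish
    when they are [<= 0], because [lam k < lam 0]; when they are [>= 0] the first
    sum is already a sum of nonnegative terms. In both cases [t 0 = 0], whereas
    [F 0 G 0 > 0] ([one_sign_contradiction]). When at most two of the products
    are nonzero, one of them is that of [k = 0], so this case reduces to the
    previous one ([two_terms_one_sign]).

    Three analytic facts carry this argument.

    Green's identity ([green]). For compactly supported test functions it follows
    from Fubini and the fundamental theorem of calculus. A test function [w] that
    vanishes on the boundary is first multiplied by a function of
    [N (w^2 + phi 0 ^2)] that cuts off a neighbourhood of the boundary; since
    [phi 0] is positive in the domain, the cutoff tends to 1 everywhere, and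
    dominated convergence applies.

    Simplicity of [lam 0] ([eigenfunction_proportional]), by Picone's identity:
    testing the equation of another eigenfunction [u] with [u], and that of
    [v = phi 0] with [u^2 / (v + e)], and letting [e] tend to 0, shows that
    [v grad u = u grad v], so that [u / v] is constant on the connected domain.
    Green's identity for [phi 0] tested with itself gives [lam 0 < 0] ([lam_lt0]).

    Integration of the Fourier series of [g] against [nu]. If [nu] has a square
    integrable density, this is continuity of the inner product
    ([fourier_nu_density]). If [sum_k F k / lam k phi k] converges uniformly, the
    coefficients of [g] are [F k / lam k] times a constant times
    [lam k / (lam k - z)], a sequence of bounded variation because [z] is not real
    and [lam] is monotone; summation by parts then shows that the Fourier series
    of [g] converges uniformly, and its limit is [g] ([fourier_nu_uniform]). *)

(** * Lebesgue measure of balls and open sets *)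

Section EuclideanMeasure.
Context (R : realType).

(** Bounded on [D] and continuous at the points of [D], as a function on the
    whole space: nothing is required at the boundary. *)
Definition bcont n (D : set 'rV[R]_n) (f : 'rV[R]_n -> R) : Prop :=
  (forall x, D x -> {for x, continuous f}) /\
  exists M, forall x, D x -> `|f x| <= M.

Lemma open_measurable_euc n (U : set 'rV[R]_n) :
  open U -> measurable (U : set (euc R n)).
Proof. by move=> oU; apply: sub_sigma_algebra. Qed.

Lemma ball_measurable_euc n (y : 'rV[R]_n) (e : R) :
  measurable (ball y e : set (euc R n)).
Proof. by apply: open_measurable_euc; exact: ball_open. Qed.

Lemma continuous_measurable_euc n (D : set 'rV[R]_n) (f : 'rV[R]_n -> R) :
  open D -> (forall x, D x -> {for x, continuous f}) ->
  measurable_fun (D : set (euc R n)) f.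
Proof.
move=> oD cf.
apply: (@measurability _ _ (euc R n) (measurableTypeR R) _ _ _
  (RGenOpens.measurableE R)).
move=> _ [_ [a [b ->] <-]]; apply: open_measurable_euc.
rewrite openE => x [Dx fx].
rewrite /interior; apply: filterI; first exact: open_nbhs_nbhs.
by apply: (cf x Dx); apply: open_nbhs_nbhs; split => //; exact: interval_open.
Qed.

Lemma bcont_integrable n (m : {measure set (euc R n) -> \bar R})
    (D : set 'rV[R]_n) f :
  open D -> (m D < +oo)%E -> bcont D f -> m.-integrable D (EFin \o f).
Proof.
move=> oD mD [cf [M fM]]; apply: measurable_bounded_integrable => //.
- exact: open_measurable_euc.
- exact: continuous_measurable_euc.
- exists M; split; first exact: num_real.
  by move=> r Mr x Dx; exact: le_trans (fM _ Dx) (ltW Mr).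
Qed.

Lemma coord_scalar (t : R) : (t%:M : 'rV[R]_1) 0 0 = t.
Proof. by rewrite mxE eqxx mulr1n. Qed.

Lemma rv_consE0 n (t : R) (y : 'rV[R]_n) :
  (rv_cons (t, y) : 'rV[R]_n.+1) 0 ord0 = t.
Proof.
rewrite -[RHS]coord_scalar -(@row_mxEl _ 1 1 n t%:M y 0 0).
by rewrite /rv_cons; congr (fun_of_matrix _ _ _); apply/val_inj.
Qed.

Lemma rv_consES n (t : R) (y : 'rV[R]_n) k :
  (rv_cons (t, y) : 'rV[R]_n.+1) 0 (lift ord0 k) = y 0 k.
Proof.
rewrite -(@row_mxEr _ 1 1 n t%:M y 0 k).
by rewrite /rv_cons; congr (fun_of_matrix _ _ _); apply/val_inj.
Qed.

Lemma rv_normE n (x : 'rV[R]_n) :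
  `|x| = \big[Num.max/0]_i `|x i.1 i.2| :> R.
Proof. by rewrite {1}/Num.norm /= mx_normrE. Qed.

Lemma norm_rv_cons n (t : R) (y : 'rV[R]_n) :
  `|rv_cons (t, y) : 'rV[R]_n.+1| = Num.max `|t| `|y|.
Proof.
apply/le_anti/andP; split.
  rewrite rv_normE; apply/bigmax_leP; split; first by rewrite le_max normr_ge0.
  move=> [i j] _ /=; rewrite ord1; case: (unliftP ord0 j) => [k|] ->.
    rewrite rv_consES le_max rv_normE.
    by rewrite (le_bigmax _ (fun ij => `|y ij.1 ij.2|) (0, k)) orbT.
  by rewrite rv_consE0 le_max lexx.
rewrite ge_max; apply/andP; split.
  rewrite rv_normE.
  by apply: le_trans (le_bigmax _ _ (0, ord0)) => /=; rewrite rv_consE0.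
rewrite [leLHS]rv_normE; apply/bigmax_leP; split => //.
move=> [i j] _ /=; rewrite ord1 [leRHS]rv_normE.
by apply: le_trans (le_bigmax _ _ (0, lift ord0 j)) => /=; rewrite rv_consES.
Qed.

Lemma rv_cons_lin n (h : R) (t s : R) (x y : 'rV[R]_n) :
  h *: (rv_cons (t, x) : 'rV[R]_n.+1) + rv_cons (s, y) =
  rv_cons (h * t + s, h *: x + y).
Proof.
apply/rowP => j; rewrite [LHS]mxE [X in X + _]mxE.
case: (unliftP ord0 j) => [k|] ->; first by rewrite !rv_consES !mxE.
by rewrite !rv_consE0.
Qed.

Lemma rv_consP n (x : 'rV[R]_n.+1) :
  {p : R * 'rV[R]_n | x = rv_cons p}.
Proof.
exists (x 0 ord0, \row_j x 0 (lift ord0 j)).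
apply/rowP => j; case: (unliftP ord0 j) => [k|] ->.
  by rewrite rv_consES mxE.
by rewrite rv_consE0.
Qed.

Lemma rv_consB n (t s : R) (x y : 'rV[R]_n) :
  (rv_cons (t, x) : 'rV[R]_n.+1) - rv_cons (s, y) = rv_cons (t - s, x - y).
Proof.
by rewrite addrC -scaleN1r rv_cons_lin mulN1r scaleN1r addrC [- y + _]addrC.
Qed.

Lemma delta_mx_rv_cons0 n :
  delta_mx 0 ord0 = rv_cons (1, 0) :> 'rV[R]_n.+1.
Proof.
apply/rowP => j; rewrite [LHS]mxE eqxx /=; case: (unliftP ord0 j) => [k|] ->.
  by rewrite rv_consES mxE.
by rewrite rv_consE0.
Qed.

Lemma delta_mx_rv_consS n (i : 'I_n) :
  delta_mx 0 (lift ord0 i) = rv_cons (0, delta_mx 0 i) :> 'rV[R]_n.+1.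
Proof.
apply/rowP => j; rewrite [LHS]mxE eqxx /=; case: (unliftP ord0 j) => [k|] ->.
  by rewrite rv_consES mxE eqxx /= (inj_eq lift_inj).
by rewrite rv_consE0.
Qed.

Lemma continuous_rv_cons n (g : 'rV[R]_n.+1 -> R) : continuous g ->
  (forall y, continuous (fun t => g (rv_cons (t, y)))) /\
  (forall t, continuous (fun y : 'rV[R]_n => g (rv_cons (t, y)))).
Proof.
move=> cg; split => [y t|t y].
  have c : continuous (fun t : R => rv_cons (t, y) : 'rV[R]_n.+1).
    move=> {}t; apply/cvgrPdist_lt => e e0.
    apply/nbhs_ballP; exists e => //= s ts.
    by rewrite rv_consB norm_rv_cons subrr normr0 gt_max e0 andbT.
  exact: (continuous_comp (c t) (cg _)).
have c : continuous (fun y : 'rV[R]_n => rv_cons (t, y) : 'rV[R]_n.+1).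
  move=> {}y; have nf : Filter (nbhs y) by exact: nbhs_filter.
  apply/cvgrPdist_lt => e e0.
  apply: (@filterS _ _ nf _ _ _ (nbhsx_ballx y e e0)) => s.
  by rewrite -ball_normE /= rv_consB norm_rv_cons subrr normr0 gt_max e0.
exact: (continuous_comp (c y) (cg _)).
Qed.

Lemma leb_cons n (A : set (euc R n.+1)) :
  leb R n.+1 A = (@lebesgue_measure R \x leb R n)%E (@rv_cons R n @^-1` A).
Proof. by []. Qed.

(** Lebesgue measure charges every ball, by induction on the dimension: a ball
    of the sup norm is a product of lower-dimensional balls. *)
Lemma leb_ball n (x : 'rV[R]_n) (e : R) : 0 < e ->
  (0 < leb R n (ball x e : set (euc R n)))%E /\
  (leb R n (ball x e : set (euc R n)) < +oo)%E.
Proof.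
move=> e0; elim: n x => [|n IH] x.
  have -> : leb R 0 (ball x e : set (euc R 0)) = 1%E.
    rewrite -[LHS]/(@dirac _ (euc R 0) (0 : 'rV[R]_0) R (ball x e)).
    by rewrite diracE mem_set// (thinmx0 x); exact: ballxx.
  by rewrite lte01 ltry.
have [[t y] ->] := rv_consP x.
rewrite leb_cons.
rewrite (_ : _ @^-1` _ = (ball t e : set (measurableTypeR R)) `*`
                         (ball y e : set (euc R n))); last first.
  apply/seteqP; split => -[s z]; rewrite -!ball_normE /= rv_consB norm_rv_cons.
    by rewrite gt_max => /andP[].
  by move=> [? ?]; rewrite gt_max; apply/andP.
rewrite product_measure1E//; [|exact: measurable_ball|exact: ball_measurable_euc].
have [p q] := IH y.
rewrite [X in (X * _)%E](_ : _ = (e *+ 2)%:E); last first.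
  exact: lebesgue_measure_ball (ltW e0).
split; first by rewrite mule_gt0// lte_fin; lra.
by rewrite lte_mul_pinfty// ?lee_fin; lra.
Qed.

Lemma leb_bounded_lty n (D : set 'rV[R]_n) :
  open D -> bounded_set D -> (leb R n (D : set (euc R n)) < +oo)%E.
Proof.
move=> oD [M [_ DM]].
have [_] := @leb_ball n 0 (`|M| + 2) ltac:(by rewrite ltr_wpDl).
apply: le_lt_trans; apply: le_measure.
- by rewrite inE; exact: open_measurable_euc.
- by rewrite inE; exact: ball_measurable_euc.
- move=> x Dx; rewrite -ball_normE /= sub0r normrN.
  apply: le_lt_trans (DM (`|M| + 1) _ x Dx) _; last by rewrite ltrD2l ltr1n.
  by rewrite ltr_pwDr// ler_norm.
Qed.

Lemma leb_open_gt0 n (U : set 'rV[R]_n) : open U -> U !=set0 ->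
  (0 < leb R n (U : set (euc R n)))%E.
Proof.
move=> oU [x Ux].
have /nbhs_ballP[e /= e0 xe] : nbhs x U by exact: open_nbhs_nbhs.
have [+ _] := leb_ball x e0; move=> /lt_le_trans; apply.
apply: le_measure => //.
- by rewrite inE; exact: ball_measurable_euc.
- by rewrite inE; exact: open_measurable_euc.
Qed.

End EuclideanMeasure.

(** * Integrals of derivatives of compactly supported functions *)

(** Both derivatives are limits of the same difference quotients. *)
Lemma is_derive_along (R : realType) (V V' : normedModType R)
    (f : V -> R) (g : V' -> R) (x v : V) (y w : V') (df : R) :
  (forall h : R, f (h *: v + x) = g (h *: w + y)) ->
  is_derive x v f df -> is_derive y w g df.
Proof.
move=> fg; have fgx : f x = g y by have := fg 0; rewrite !scale0r !add0r.
have E : (fun h : R => h^-1 *: ((f \o shift x) (h *: v) - f x)) =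
         (fun h : R => h^-1 *: ((g \o shift y) (h *: w) - g y)).
  by apply/funext => h /=; rewrite fg fgx.
by move=> [d <-]; split; move: d; rewrite /derivable /derive E.
Qed.

Section DivergenceTheorem.
Context (R : realType).

Lemma bounded_set_closure n (D : set 'rV[R]_n) :
  bounded_set D -> bounded_set (closure D).
Proof.
move=> [M [Mr DM]]; exists M; split => // r Mr' x cDx.
have cB : closed [set x : 'rV[R]_n | `|x| <= r].
  have /continuous_closedP h : continuous (fun x : 'rV[R]_n => `|x|).
    by move=> z; exact: norm_continuous.
  exact: (h _ (@closed_le R r)).
have := closureS (DM _ Mr') cDx.
by rewrite -(iffLR (closure_id _) cB).
Qed.

(** The restriction of [g] to [D] is bounded because [closure D] is compact. *)
Lemma continuous_compact_support_integrable n
    (m : {measure set (euc R n) -> \bar R}) (D : set 'rV[R]_n) g :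
  open D -> bounded_set D -> (m (D : set (euc R n)) < +oo)%E -> continuous g ->
  (forall x, ~ D x -> g x = 0) -> m.-integrable setT (EFin \o g).
Proof.
move=> oD bD mD cg g0.
have [M [_ gM]] : bounded_set (g @` closure D).
  apply: compact_bounded; apply: continuous_compact.
    exact: continuous_subspaceT.
  apply: bounded_closed_compact; last exact: closed_closure.
  exact: bounded_set_closure.
rewrite (_ : g = g \_ D); last first.
  apply/funext => x; rewrite patchE; case: ifPn => // /negP xD.
  by apply: g0 => Dx; apply: xD; rewrite inE.
have mD' := open_measurable_euc oD.
rewrite -restrict_EFin; apply/(integrable_mkcond _ _).1 => //.
apply: bcont_integrable => //; split; first by move=> x _; exact: cg.
exists (`|M| + 1) => x Dx; apply: (gM (`|M| + 1)).
  by rewrite ltr_pwDr// ler_norm.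
by exists x => //; exact: subset_closure.
Qed.

(** The fundamental theorem of calculus on a segment beyond which [f] is zero. *)
Lemma integral_derivative_line (f g : R -> R) (M : R) :
  (forall t : R, is_derive t (1 : R) f (g t)) -> continuous g ->
  (forall t, M < `|t| -> f t = 0 /\ g t = 0) ->
  (\int[@lebesgue_measure R]_t (g t)%:E = 0)%E.
Proof.
move=> fg cg fM; set N := `|M| + 1.
have MN (t : R) : N <= `|t| -> M < `|t|.
  by apply: lt_le_trans; rewrite ltr_pwDr// ler_norm.
have N0 : 0 < N by rewrite ltr_wpDl.
have cf : continuous f.
  move=> t; apply/differentiable_continuous/derivable1_diffP.
  by have [] := fg t.
rewrite (_ : (fun t => (g t)%:E) = (EFin \o g) \_ `[- N, N]%classic); last first.
  apply/funext => t; rewrite patchE; case: ifPn => //.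
  rewrite notin_setE /= in_itv /= => /negP; rewrite -ler_norml -ltNge => Nt.
  by have [_ ->] := fM t (MN _ (ltW Nt)).
rewrite -integral_mkcond.
rewrite (@continuous_FTC2 _ g f).
- have [-> _] := fM N (MN _ (ler_norm _)).
  have [|-> _] := fM (- N); last by rewrite sube0.
  by apply: MN; rewrite normrN ler_norm.
- by rewrite -subr_gt0 opprK addr_gt0.
- exact: continuous_subspaceT.
- split; first by move=> t _; have [] := fg t.
  + exact/cvg_at_right_filter/cf.
  + exact/cvg_at_left_filter/cf.
- by move=> t _; rewrite derive1E; have [_ ->] := fg t.
Qed.

Lemma integral_leb_cons n (g : 'rV[R]_n.+1 -> R) D :
  open D -> bounded_set D -> continuous g ->
  (forall x, ~ D x -> g x = 0) ->
  (\int[leb R n.+1]_x (g x)%:E =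
     \int[@lebesgue_measure R]_t \int[leb R n]_y (g (rv_cons (t, y)))%:E /\
   \int[leb R n.+1]_x (g x)%:E =
     \int[leb R n]_y \int[@lebesgue_measure R]_t (g (rv_cons (t, y)))%:E)%E.
Proof.
move=> oD bD cg g0.
have mg : measurable_fun setT (EFin \o (g : euc R n.+1 -> R)).
  apply/measurable_EFinP; apply: continuous_measurable_euc; first exact: openT.
  by move=> x _; exact: cg.
have ig : (leb R n.+1).-integrable setT (EFin \o g).
  by apply: (continuous_compact_support_integrable oD) => //; exact: leb_bounded_lty.
have ig' : (@lebesgue_measure R \x leb R n)%E.-integrable setT
    ((EFin \o g) \o @rv_cons R n).
  apply/integrableP; split.
    by apply: measurableT_comp => //; exact: measurable_rv_cons.
  move/integrableP : ig => [_]; apply: le_lt_trans.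
  rewrite [leRHS](@ge0_integral_pushforward _ _ _ _ _ _ (@measurable_rv_cons R n)
    (@lebesgue_measure R \x leb R n)%E setT)//.
  by apply: measurableT_comp.
have E : (\int[leb R n.+1]_x (g x)%:E =
    \int[@lebesgue_measure R \x leb R n]_p (g (rv_cons p))%:E)%E.
  exact: (@integral_pushforward _ _ _ _ _ _ (@measurable_rv_cons R n)
    (@lebesgue_measure R \x leb R n)%E setT _ mg).
split.
  rewrite E.
  by rewrite -(@integral12_prod_meas1 _ _ _ _ _ _ _ _ ig').
rewrite E.
by rewrite -(@integral21_prod_meas1 _ _ _ _ _ _ _ _ ig').
Qed.

(** Fubini, integrating first along the coordinate that is differentiated. *)
Lemma integral_partial_eq0 n (i : 'I_n) (f g : 'rV[R]_n -> R) M :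
  (forall x, is_derive x (delta_mx 0 i) f (g x)) -> continuous g ->
  (forall x, M < `|x| -> f x = 0 /\ g x = 0) ->
  (\int[leb R n]_x (g x)%:E = 0)%E.
Proof.
elim: n i f g => [[]//|n IH] i f g fg cg fM.
have bB : bounded_set (ball (0 : 'rV[R]_n.+1) (`|M| + 1)).
  exists (`|M| + 1); split; first exact: num_real.
  move=> r Mr x; rewrite -ball_normE /= sub0r normrN => Mx.
  exact/ltW/(lt_trans Mx).
have g0 x : ~ ball (0 : 'rV[R]_n.+1) (`|M| + 1) x -> g x = 0.
  rewrite -ball_normE /= sub0r normrN => /negP; rewrite -leNgt => Mx.
  apply: (fM x _).2; apply: lt_le_trans Mx.
  by rewrite ltr_pwDr// ler_norm.
have [E1 E2] := integral_leb_cons (ball_open _ _) bB cg g0.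
have [c1 c2] := continuous_rv_cons cg.
case: (unliftP ord0 i) fg => [j|] -> fg.
  rewrite E1 integral0_eq// => t _.
  apply: (IH j (fun y => f (rv_cons (t, y)))) => //; last first.
    by move=> x Mx; apply: fM; rewrite norm_rv_cons lt_max Mx orbT.
  move=> y; apply: (is_derive_along _ (fg (rv_cons (t, y)))) => h.
  by rewrite delta_mx_rv_consS rv_cons_lin mulr0 add0r.
rewrite E2 integral0_eq// => y _.
pose fy (t : R) := f (rv_cons (t, y)).
pose gy (t : R) := g (rv_cons (t, y)).
have dfy (t : R) : is_derive t (1 : R) fy (gy t).
  have H (h : R) : f (h *: delta_mx 0 ord0 + (rv_cons (t, y) : 'rV[R]_n.+1)) =
      fy (h *: (1 : R) + t).
    by rewrite delta_mx_rv_cons0 rv_cons_lin scaler0 add0r.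
  exact: (@is_derive_along R _ R f fy _ _ t 1 _ H (fg _)).
apply: (@integral_derivative_line fy gy M dfy (c1 y)) => t Mt.
by apply: fM; rewrite norm_rv_cons lt_max Mt.
Qed.

End DivergenceTheorem.

(** * Integration against a measure with a density *)

Section Density.
Context d (T : measurableType d) (R : realType).
Variables (mu nu : {measure set T -> \bar R}) (D : set T) (h : T -> R).
Hypotheses (mD : measurable D) (mh : measurable_fun D h)
  (h0 : forall x, D x -> 0 <= h x)
  (nuE : forall A, measurable A -> nu A = (\int[mu]_(x in A `&` D) (h x)%:E)%E).

Import HBNNSimple.

(** On each level set of a simple function the claim is [nuE] itself. *)
Lemma nnsfun_integral_density (f : {nnsfun T >-> R}) :
  (\int[nu]_(x in D) (f x)%:E = \int[mu]_(x in D) (f x * h x)%:E)%E.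
Proof.
have mfr r : measurable (f @^-1` [set r]) by [].
have mr (r : R) :
    measurable_fun D (fun x => (r * \1_(f @^-1` [set r]) x * h x)%:E).
  apply/measurable_EFinP; apply: measurable_funM => //.
  by apply: measurable_funTS; exact: measurable_funM.
transitivity (\sum_(r \in range f)
    \int[mu]_(x in D) (r * \1_(f @^-1` [set r]) x * h x)%:E)%E.
  under eq_integral do rewrite fimfunE -fsumEFin//.
  rewrite ge0_integral_fsum//; last 2 first.
  - by move=> y; exact/measurable_EFinP/measurable_funM.
  - by move=> y x _; rewrite nnfun_muleindic_ge0.
  apply: eq_fsbigr => r _; rewrite integralZl_indic_nnsfun// integral_indic//=.
  have [r0|r0] := ltP r 0.
    rewrite preimage_nnfun0// set0I measure0 mule0 integral0_eq// => x _.
    by rewrite indicE in_set0 /= mulr0 mul0r.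
  rewrite nuE; last exact: measurableI.
  rewrite -setIA setIid setIC integral_mkcondr -ge0_integralZl_EFin//.
  - apply: eq_integral => x _; rewrite patchE indicE.
    case: ifPn => _ /=; first by rewrite mulr1 EFinM.
    by rewrite mulr0 mul0r mule0.
  - by move=> x Dx; rewrite patchE; case: ifPn => // _; rewrite lee_fin h0.
  - apply/measurable_restrict => //.
    apply: measurable_funS (iffRL (measurable_EFinP _ _) mh) => //.
rewrite -ge0_integral_fsum//.
- apply: eq_integral => x _; under eq_fsbigr do rewrite EFinM.
  rewrite -ge0_mule_fsuml => [|r]; last exact: nnfun_muleindic_ge0.
  by rewrite fsumEFin// -fimfunE EFinM.
- by move=> r x Dx; rewrite lee_fin mulr_ge0 ?h0// -lee_fin EFinM nnfun_muleindic_ge0.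
Qed.

(** Monotone convergence along simple functions. *)
Lemma ge0_integral_density (f : T -> \bar R) :
  measurable_fun D f -> (forall x, D x -> 0 <= f x)%E ->
  (\int[nu]_(x in D) f x = \int[mu]_(x in D) (f x * (h x)%:E))%E.
Proof.
move=> mf f0; pose f_ := nnsfun_approx mD mf.
transitivity (limn (fun n => \int[nu]_(x in D) (f_ n x)%:E))%E.
  rewrite -monotone_convergence//.
  - apply: eq_integral => y /[!inE] yD; apply/esym/cvg_lim => //.
    exact: cvg_nnsfun_approx.
  - by move=> n; exact/measurable_EFinP/measurable_funTS/measurable_funP.
  - by move=> n y _; rewrite lee_fin.
  - by move=> y _ m n mn; rewrite lee_fin; exact/lefP/nd_nnsfun_approx.
under eq_fun do rewrite nnsfun_integral_density.
rewrite -monotone_convergence//.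
- apply: eq_integral => y /[!inE] yD; apply/cvg_lim => //.
  under eq_fun do rewrite EFinM.
  by apply: cvgeZr => //; exact: cvg_nnsfun_approx.
- move=> n; apply/measurable_EFinP/measurable_funM => //.
  exact/measurable_funTS/measurable_funP.
- by move=> n y Dy; rewrite lee_fin mulr_ge0 ?h0.
- move=> y Dy m n mn; rewrite lee_fin ler_wpM2r ?h0//.
  exact/lefP/nd_nnsfun_approx.
Qed.

Lemma integral_density (f : T -> R) :
  nu.-integrable D (EFin \o f) ->
  mu.-integrable D (fun x => (f x * h x)%:E) /\
  (\int[nu]_(x in D) (f x)%:E = \int[mu]_(x in D) (f x * h x)%:E)%E.
Proof.
move=> nuf; have /integrableP[mf fnu] := nuf.
have mf' : measurable_fun D f by exact/measurable_EFinP.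
have imu : mu.-integrable D (fun x => (f x * h x)%:E).
  apply/integrableP; split; first exact/measurable_EFinP/measurable_funM.
  move: fnu; rewrite ge0_integral_density//; last exact: measurableT_comp.
  congr (_ < _)%E; apply: eq_integral => x /[!inE] Dx /=.
  by rewrite -EFinM normrM (ger0_norm (h0 Dx)).
split=> //.
rewrite integralE [RHS]integralE; congr (_ - _)%E.
  rewrite ge0_integral_density//; last exact: measurable_funepos.
  apply: eq_integral => x /[!inE] Dx; rewrite !funeposE /=.
  rewrite EFinM maxe_pMl ?mul0e// ?lee_fin ?h0//.
rewrite ge0_integral_density//; last exact: measurable_funeneg.
apply: eq_integral => x /[!inE] Dx; rewrite !funenegE /=.
by rewrite -mulNr EFinM maxe_pMl ?mul0e// lee_fin h0.
Qed.

End Density.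

(** * Calculus of bounded C^1 functions, and the divergence theorem *)

Section Calculus.
Context (R : realType) (n : nat).
Local Notation V := 'rV[R]_n.
Implicit Types (D K : set V) (f g : V -> R) (df dg : 'I_n -> V -> R).
Local Notation e_ i := (delta_mx 0 i : V).

Lemma open_near D (P : V -> Prop) x : open D -> D x ->
  (forall y, D y -> P y) -> \near x, P x.
Proof.
move=> oD Dx DP; have nf : Filter (nbhs x) by exact: nbhs_filter.
exact: (@filterS _ _ nf _ _ DP (open_nbhs_nbhs (conj oD Dx))).
Qed.

Lemma near_eq_continuous f g x : (\near x, f x = g x) ->
  {for x, continuous f} -> {for x, continuous g}.
Proof.
move=> fg cf; rewrite /prop_for /continuous_at -(nbhs_singleton fg).
have nf : Filter (nbhs x) by exact: nbhs_filter.
exact: (cvg_trans (@near_eq_cvg _ _ (nbhs x) nf f g fg) cf).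
Qed.

Lemma bcont_cst D c : bcont D (fun _ => c).
Proof. by split; [move=> x _; exact: cst_continuous|exists `|c|]. Qed.

Lemma bcont_eq D f g : open D -> (forall x, D x -> f x = g x) ->
  bcont D f -> bcont D g.
Proof.
move=> oD fg [cf [M fM]]; split; last by exists M => x Dx; rewrite -fg//; exact: fM.
move=> x Dx; apply: near_eq_continuous (cf x Dx).
by apply: (open_near oD Dx) => y /fg.
Qed.

Lemma bcontD D f g : bcont D f -> bcont D g -> bcont D (fun x => f x + g x).
Proof.
move=> [cf [M fM]] [cg [N gN]]; split.
  by move=> x Dx; apply: continuousD; [exact: cf|exact: cg].
exists (M + N) => x Dx; apply: (le_trans (ler_normD _ _)).
by apply: lerD; [exact: fM|exact: gN].
Qed.

Lemma bcontM D f g : bcont D f -> bcont D g -> bcont D (fun x => f x * g x).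
Proof.
move=> [cf [M fM]] [cg [N gN]]; split.
  by move=> x Dx; apply: continuousM; [exact: cf|exact: cg].
exists (M * N) => x Dx; rewrite normrM.
by apply: ler_pM => //; [exact: fM|exact: gN].
Qed.

Lemma bcontZ D c f : bcont D f -> bcont D (fun x => c * f x).
Proof. by apply: bcontM; exact: bcont_cst. Qed.

Lemma bcontN D f : bcont D f -> bcont D (fun x => - f x).
Proof.
move=> /(bcontZ (-1)); congr bcont.
by apply/funext => x; rewrite mulN1r.
Qed.

Lemma bcontB D f g : bcont D f -> bcont D g -> bcont D (fun x => f x - g x).
Proof. by move=> bf /bcontN; exact: bcontD. Qed.

Lemma bcontX D f k : bcont D f -> bcont D (fun x => f x ^+ k).
Proof.
move=> bf; elim: k => [|k IH].
  exact: bcont_cst.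
by under eq_fun do rewrite exprS; exact: bcontM.
Qed.

Lemma bcont_sum D (I : Type) (r : seq I) (P : pred I) (F : I -> V -> R) :
  (forall i, P i -> bcont D (F i)) ->
  bcont D (fun x => \sum_(i <- r | P i) F i x).
Proof.
move=> bF; elim: r => [|i r IH].
  by under eq_fun do rewrite big_nil; exact: bcont_cst.
have [Pi|nPi] := boolP (P i).
  by under eq_fun do rewrite big_cons Pi; apply: bcontD => //; exact: bF.
by under eq_fun do rewrite big_cons (negbTE nPi).
Qed.

Lemma bcontV D f e : 0 < e -> (forall x, D x -> e <= f x) ->
  bcont D f -> bcont D (fun x => (f x)^-1).
Proof.
move=> e0 ef [cf _]; split.
  move=> x Dx; apply: continuousV; last exact: cf.
  exact: lt0r_neq0 (lt_le_trans e0 (ef x Dx)).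
exists e^-1 => x Dx; have fx0 := lt_le_trans e0 (ef x Dx).
rewrite normfV gtr0_norm//.
by rewrite lef_pV2; [exact: ef|rewrite posrE|rewrite posrE].
Qed.

(** The gradient is explicit data, so that the calculus rules below compute it;
    only its values on [D] matter. *)
Definition C1b D f df : Prop :=
  bcont D f /\ forall i, (forall x, D x -> is_derive x (e_ i) f (df i x)) /\
                         bcont D (df i).

Lemma C1bM D f df g dg : C1b D f df -> C1b D g dg ->
  C1b D (fun x => f x * g x) (fun i x => df i x * g x + f x * dg i x).
Proof.
move=> [bf Hf] [bg Hg]; split; first exact: bcontM.
move=> i; have [dfi bdfi] := Hf i; have [dgi bdgi] := Hg i; split; last first.
  by apply: bcontD; exact: bcontM.
move=> x Dx; have Ff := dfi x Dx; have Fg := dgi x Dx.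
have := @is_deriveM R V f g x (e_ i) _ _ Ff Fg.
have -> // : f x *: dg i x + g x *: df i x = df i x * g x + f x * dg i x.
by rewrite addrC [df i x * _]mulrC.
Qed.

Lemma C1bD D f df g dg : C1b D f df -> C1b D g dg ->
  C1b D (fun x => f x + g x) (fun i x => df i x + dg i x).
Proof.
move=> [bf Hf] [bg Hg]; split; first exact: bcontD.
move=> i; have [dfi bdfi] := Hf i; have [dgi bdgi] := Hg i; split; last first.
  exact: bcontD.
by move=> x Dx; have Ff := dfi x Dx; have Fg := dgi x Dx; exact: is_deriveD.
Qed.

Lemma C1b_cst D c : C1b D (fun _ => c) (fun _ _ => 0).
Proof.
split; first exact: bcont_cst.
by move=> i; split; [move=> x _; exact: is_derive_cst|exact: bcont_cst].
Qed.

Lemma C1bV D f df e : 0 < e -> (forall x, D x -> e <= f x) -> C1b D f df ->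
  C1b D (fun x => (f x)^-1) (fun i x => - ((f x)^-1 ^+ 2) * df i x).
Proof.
move=> e0 ef [bf Hf]; have bV := bcontV e0 ef bf; split => // i.
have [dfi bdfi] := Hf i; split; last first.
  by apply: bcontM => //; apply: bcontN; exact: bcontX.
move=> x Dx; have fx0 := lt0r_neq0 (lt_le_trans e0 (ef x Dx)).
have [d E] := dfi x Dx; split; first exact: derivableV.
by rewrite deriveV// E exprVn.
Qed.

(** The derivative along [v] is that of the restriction to a line, to which the
    one-dimensional chain rule applies. *)
Lemma is_derive_compose (P : R -> R) (f : V -> R) x v (dP df : R) :
  is_derive (f x) (1 : R) P dP -> is_derive x v f df ->
  is_derive x v (fun y => P (f y)) (dP * df).
Proof.
move=> HP Hf.
have fline : is_derive (0 : R) (1 : R) (fun h : R => f (h *: v + x)) df.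
  have H (h : R) : f (h *: v + x) = (fun h : R => f (h *: v + x)) (h *: (1 : R) + 0).
    by rewrite addr0 /= [h *: 1]mulr1.
  exact: (@is_derive_along R V R f (fun h => f (h *: v + x)) _ _ 0 1 _ H Hf).
have HP' : is_derive (f (0 *: v + x)) (1 : R) P dP by rewrite scale0r add0r.
have cline : is_derive (0 : R) (1 : R) (P \o (fun h : R => f (h *: v + x))) (dP * df).
  have [d1 E1] := HP'; have [d2 E2] := fline.
  have dd : derivable (P \o (fun h : R => f (h *: v + x))) 0 1.
    move/derivable1_diffP : d1 => d1; move/derivable1_diffP : d2 => d2.
    exact/derivable1_diffP/differentiable_comp.
  split => //.
  have := derive1_comp d2 d1; rewrite !derive1E => ->.
  by congr (_ * _).
have H (h : R) : (P \o (fun h : R => f (h *: v + x))) (h *: (1 : R) + 0) =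
    (fun y => P (f y)) (h *: v + x).
  by rewrite addr0 /= [h *: 1]mulr1.
exact: (@is_derive_along R R V (P \o (fun h => f (h *: v + x)))
  (fun y => P (f y)) _ _ x v _ H cline).
Qed.

(** A field that vanishes off a closed subset of [D] extends by zero to a field
    on the whole space that is as smooth as it was on [D]. *)
Lemma integral_divergence_eq0 D K (W dW : 'I_n -> V -> R) :
  open D -> bounded_set D -> closed K -> K `<=` D ->
  (forall i x, D x -> is_derive x (e_ i) (W i) (dW i x)) ->
  (forall i x, D x -> {for x, continuous (dW i)}) ->
  (forall i x, D x -> ~ K x -> W i x = 0) ->
  (leb R n).-integrable (D : set (euc R n)) (fun x => (\sum_i dW i x)%:E) /\
  (\int[leb R n]_(x in (D : set (euc R n))) (\sum_i dW i x)%:E = 0)%E.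
Proof.
move=> oD bD cK KD dWE cdW W0.
have oKC : open (~` K) by exact: closed_openC.
pose f i := W i \_ D; pose g i := dW i \_ D.
have fD i x : D x -> \near x, W i x = f i x.
  move=> Dx; apply: (open_near oD Dx) => y Dy.
  by rewrite /f patchE mem_set.
have gD i x : D x -> \near x, dW i x = g i x.
  move=> Dx; apply: (open_near oD Dx) => y Dy.
  by rewrite /g patchE mem_set.
have fK i x : ~ K x -> \near x, 0 = f i x.
  move=> Kx; apply: (open_near oKC Kx) => y Ky.
  by rewrite /f patchE; case: ifPn => // /[!inE] Dy; rewrite W0.
have dfK i x : ~ K x -> is_derive x (e_ i) (f i) 0.
  move=> Kx; have K0 : is_derive x (e_ i) (cst (0 : R) : V -> R) 0.
    exact: is_derive_cst.
  exact: (@near_eq_is_derive R V R (cst 0) (f i) x (e_ i) 0 (fK i x Kx) K0).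
have dfD i x : D x -> is_derive x (e_ i) (f i) (dW i x).
  by move=> Dx; apply: (near_eq_is_derive (fD i x Dx)); exact: dWE.
have g0 i x : ~ K x -> g i x = 0.
  move=> Kx; rewrite /g patchE; case: ifPn => // /[!inE] Dx.
  by have [_ <-] := dfD i x Dx; have [_ ->] := dfK i x Kx.
have gK i x : ~ K x -> \near x, 0 = g i x.
  move=> Kx; apply: (open_near oKC Kx) => y Ky.
  by rewrite g0.
have dfg i x : is_derive x (e_ i) (f i) (g i x).
  have [Kx|Kx] := pselect (K x); last by rewrite g0//; exact: dfK.
  by rewrite /g patchE mem_set; [exact/dfD/KD|exact: KD].
have cg i : continuous (g i).
  move=> x; have [/KD Dx|Kx] := pselect (K x).
    exact: near_eq_continuous (gD i x Dx) (cdW i x Dx).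
  exact: near_eq_continuous (gK i x Kx) (@cst_continuous _ _ _ _).
have [M [_ DM]] := bD.
have gi i : (leb R n).-integrable setT (EFin \o g i).
  apply: (continuous_compact_support_integrable oD) => //.
    exact: leb_bounded_lty.
  by move=> x Dx; rewrite /g patchE memNset.
have gI i : (\int[leb R n]_x (g i x)%:E = 0)%E.
  apply: (@integral_partial_eq0 _ _ i (f i) (g i) (`|M| + 1)) => // x Mx.
  have Dx : ~ D x.
    have hM : M < `|M| + 1 by rewrite ltr_pwDr// ler_norm.
    by move=> /(DM _ hM) /= /le_lt_trans /(_ Mx); rewrite ltxx.
  by rewrite /f /g !patchE memNset.
have mD := open_measurable_euc oD.
have E : (fun x => (\sum_i dW i x)%:E) \_ D = (fun x => \sum_i (g i x)%:E)%E.
  apply/funext => x; rewrite patchE; case: ifPn => xD.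
    rewrite sumEFin; congr (_%:E); apply: eq_bigr => i _.
    by rewrite /g patchE xD.
  rewrite big1// => i _.
  by rewrite /g patchE (negbTE xD).
have iE : (leb R n).-integrable setT (fun x => \sum_i (g i x)%:E)%E.
  by apply: integrable_sum => // i _; exact: gi.
split; first by apply/(integrable_mkcond _ mD); rewrite E.
rewrite integral_mkcond E integral_sum//; first by rewrite big1.
Qed.

End Calculus.

(** * Integrals of bounded continuous functions *)

Section BoundedIntegrals.
Context (R : realType) (n : nat).
Variables (m : {finite_measure set (euc R n) -> \bar R}) (D : set 'rV[R]_n).
Hypothesis oD : open D.
Implicit Types f g : 'rV[R]_n -> R.

Lemma bcont_fin_integrable f : bcont D f -> m.-integrable D (EFin \o f).
Proof.
move=> bf; apply: bcont_integrable => //.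
by rewrite -ge0_fin_numE//; apply: fin_num_measure; exact: open_measurable_euc.
Qed.

Let mD : measurable (D : set (euc R n)).
Proof. exact: open_measurable_euc. Qed.

Lemma RintegralD_bcont f g : bcont D f -> bcont D g ->
  (\int[m]_(x in D) (f x + g x) =
   \int[m]_(x in D) f x + \int[m]_(x in D) g x)%R.
Proof.
move=> /bcont_fin_integrable If /bcont_fin_integrable Ig.
exact: (RintegralD mD If Ig).
Qed.

Lemma RintegralB_bcont f g : bcont D f -> bcont D g ->
  (\int[m]_(x in D) (f x - g x) =
   \int[m]_(x in D) f x - \int[m]_(x in D) g x)%R.
Proof.
move=> /bcont_fin_integrable If /bcont_fin_integrable Ig.
exact: (RintegralB mD If Ig).
Qed.

Lemma RintegralZ_bcont c f : bcont D f ->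
  (\int[m]_(x in D) (c * f x) = c * \int[m]_(x in D) f x)%R.
Proof. by move=> /bcont_fin_integrable If; exact: (RintegralZl _ mD If). Qed.

Lemma Rintegral_sum_bcont (F : nat -> 'rV[R]_n -> R) N :
  (forall k, bcont D (F k)) ->
  (\int[m]_(x in D) (\sum_(0 <= k < N) F k x) =
   \sum_(0 <= k < N) \int[m]_(x in D) F k x)%R.
Proof.
move=> bF; elim: N => [|N IH].
  under eq_Rintegral do rewrite big_geq//.
  by rewrite big_geq// /Rintegral integral0.
under eq_Rintegral do rewrite big_nat_recr//=.
rewrite RintegralD_bcont ?IH ?big_nat_recr//=.
exact: bcont_sum.
Qed.

Lemma le_Rintegral_bcont f g : bcont D f -> bcont D g ->
  (forall x, D x -> f x <= g x) ->
  (\int[m]_(x in D) f x <= \int[m]_(x in D) g x)%R.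
Proof.
move=> /bcont_fin_integrable If /bcont_fin_integrable Ig.
exact: (le_Rintegral mD If Ig).
Qed.

Lemma bcont_norm f : bcont D f -> bcont D (fun x => `|f x|).
Proof.
move=> [cf [M fM]]; split; last by exists M => x Dx; rewrite normr_id fM.
move=> x Dx.
apply: (@continuous_comp _ _ _ f (fun t : R => `|t|)); first exact: cf.
exact: norm_continuous.
Qed.

Lemma ler_norm_Rintegral_bcont f g : bcont D f -> bcont D g ->
  (forall x, D x -> `|f x| <= g x) ->
  `|\int[m]_(x in D) f x|%R <= (\int[m]_(x in D) g x)%R.
Proof.
move=> bf bg fg; have If := bcont_fin_integrable bf.
apply: (le_trans (le_normr_Rintegral mD If)).
by apply: le_Rintegral_bcont => //; exact: bcont_norm.
Qed.

Lemma Rintegral_bcont_cst c :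
  (\int[m]_(x in D) c = c * fine (m (D : set (euc R n))))%R.
Proof. exact: (Rintegral_cst _ mD). Qed.

Lemma integral_EFin_bcont f : bcont D f ->
  (\int[m]_(x in D) (f x)%:E = (\int[m]_(x in D) f x)%R%:E)%E.
Proof.
move=> bf; rewrite /Rintegral fineK//.
exact: (integrable_fin_num mD (bcont_fin_integrable bf)).
Qed.

Lemma dominated_Rintegral (f_ : nat -> 'rV[R]_n -> R) f (M : R) :
  (forall N, bcont D (f_ N)) -> bcont D f ->
  (forall x, D x -> f_ ^~ x @ \oo --> f x) ->
  (forall N x, D x -> `|f_ N x| <= M) ->
  (fun N => \int[m]_(x in D) f_ N x)%R @ \oo --> (\int[m]_(x in D) f x)%R.
Proof.
move=> bf_ bf cf fM.
have mf g : bcont D g -> measurable_fun (D : set (euc R n)) (EFin \o g).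
  by move=> [cg _]; apply/measurable_EFinP; exact: continuous_measurable_euc.
have cfE : {ae m, forall x : euc R n, D x ->
    (fun N => (f_ N x)%:E) @ \oo --> (f x)%:E}.
  by apply: aeW => x Dx; apply: cvg_EFin; [exact: nearW|exact: cf].
have fME : {ae m, forall (x : euc R n) (N : nat), D x ->
    (`|(f_ N x)%:E| <= M%:E)%E}.
  by apply: aeW => x N Dx; rewrite lee_fin; exact: fM.
have [_ _] := dominated_convergence mD (fun N => mf _ (bf_ N)) (mf _ bf) cfE
  (bcont_fin_integrable (bcont_cst D M)) fME.
rewrite -[X in _ --> X -> _]/(\int[m]_(x in D) (f x)%:E)%E integral_EFin_bcont//.
by move/fine_cvgP => [].
Qed.

Hypothesis m_open : forall U : set 'rV[R]_n,
  open U -> U `<=` D -> U !=set0 -> (0 < m (U : set (euc R n)))%E.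

(** Around a point where [f] is positive, [f] exceeds a positive constant on an
    open set, which [m] charges. *)
Lemma gt0_Rintegral_bcont f : bcont D f -> (forall x, D x -> 0 <= f x) ->
  (exists2 x, D x & f x != 0) -> (0 < \int[m]_(x in D) f x)%R.
Proof.
move=> bf f0 [x Dx fx]; have [cf _] := bf.
have fx0 : 0 < f x by rewrite lt_neqAle eq_sym fx f0.
pose e := f x / 2.
pose U := D `&` f @^-1` `]e, +oo[%classic.
have oU : open U.
  rewrite openE => y [Dy fy]; rewrite /interior; apply: filterI.
    exact: open_nbhs_nbhs.
  by apply: (cf y Dy); apply: open_nbhs_nbhs; split => //; exact: interval_open.
have mU := open_measurable_euc oU.
have U0 : (0 < m (U : set (euc R n)))%E.
  apply: m_open => //; first by move=> y [].
  by exists x; split => //=; rewrite in_itv/= andbT /e; lra.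
rewrite -lte_fin -integral_EFin_bcont//.
apply: (@lt_le_trans _ _ (\int[m]_(x in (U : set (euc R n))) e%:E)%E).
  by rewrite integral_cst// mule_gt0// lte_fin /e; lra.
apply: (@le_trans _ _ (\int[m]_(x in (U : set (euc R n))) (f x)%:E)%E).
  apply: ge0_le_integral => //.
  - by move=> y _; rewrite lee_fin /e; lra.
  - apply/measurable_EFinP; apply: continuous_measurable_euc => // y [Dy _].
    exact: cf.
  - by move=> y [Dy] /=; rewrite in_itv/= andbT lee_fin => /ltW.
apply: ge0_subset_integral => //.
- apply/measurable_EFinP; exact: continuous_measurable_euc.
- by move=> y [].
Qed.

End BoundedIntegrals.

(** * Regularity of the coefficients and of the reversible weight *)

Section Regular.
Context (R : realType) (n : nat).
Local Notation V := 'rV[R]_n.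
Implicit Types (D : set V) (f g w : V -> R).
Local Notation e_ i := (delta_mx 0 i : V).

Lemma bcont_closure D f : open D -> bounded_set D ->
  {within closure D, continuous f} -> bcont D f.
Proof.
move=> oD bD cf; split.
  move=> x Dx; have := continuous_subspaceW (@subset_closure _ D) cf.
  by rewrite continuous_open_subspace// => /(_ x); apply; rewrite inE.
have [M [_ fM]] : bounded_set (f @` closure D).
  apply: compact_bounded; apply: continuous_compact => //.
  apply: bounded_closed_compact; last exact: closed_closure.
  exact: bounded_set_closure.
exists (`|M| + 1) => x Dx; apply: (fM (`|M| + 1)).
  by rewrite ltr_pwDr// ler_norm.
by exists x => //; exact: subset_closure.
Qed.

Lemma bcont_continuous D f : open D -> bounded_set D ->
  continuous f -> bcont D f.
Proof.
by move=> oD bD cf; apply: bcont_closure => //; exact: continuous_subspaceT.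
Qed.

Lemma C1b_partial D f df : open D -> C1b D f df ->
  C1b D f (fun i => partial i f).
Proof.
move=> oD [bf Hf]; split => // i; have [dfi bdfi] := Hf i; split.
  by move=> x Dx; have [d _] := dfi x Dx; exact: derivableP.
apply: (bcont_eq oD) bdfi => x Dx.
by have [_ <-] := dfi x Dx.
Qed.

Definition C2b D f : Prop :=
  C1b D f (fun i => partial i f) /\
  forall j, C1b D (partial j f) (fun i => partial i (partial j f)).

Lemma C_extends0_bcont D f : open D -> bounded_set D ->
  C_extends 0 D f -> bcont D f.
Proof.
move=> oD bD [[g [cg gf]] _].
by apply: (bcont_eq oD gf); exact: bcont_closure.
Qed.

Lemma C_extends1_C1b D f : open D -> bounded_set D ->
  C_extends 1 D f -> C1b D f (fun i => partial i f).
Proof.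
move=> oD bD [fe Hf]; split; first exact: C_extends0_bcont.
move=> i; have [fi pf] := Hf i; split; last exact: C_extends0_bcont.
by move=> x Dx; apply: derivableP; exact: fi.
Qed.

Lemma C_closure_C2b D f : open D -> bounded_set D ->
  C_closure 2 D f -> C2b D f.
Proof.
move=> oD bD [_ [fe Hf]]; split; last first.
  by move=> j; have [_] := Hf j; exact: C_extends1_C1b.
split; first exact: C_extends0_bcont.
move=> i; have [fi [pf _]] := Hf i; split; last exact: C_extends0_bcont.
by move=> x Dx; apply: derivableP; exact: fi.
Qed.

Lemma C_hoelder2_C1b D alpha f : open D -> bounded_set D ->
  C_hoelder 2 alpha f -> C1b D f (fun i => partial i f).
Proof.
move=> oD bD [cf Hf]; split; first exact: bcont_continuous.
move=> i; have [fi [cpf _]] := Hf i; split; last exact: bcont_continuous.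
by move=> x _; apply: derivableP; exact: fi.
Qed.

Lemma bcont_prod D (I : Type) (r : seq I) (P : pred I) (F : I -> V -> R) :
  (forall i, bcont D (F i)) ->
  bcont D (fun x => \prod_(i <- r | P i) F i x).
Proof.
move=> bF; elim: r => [|i r IH].
  by under eq_fun do rewrite big_nil; exact: bcont_cst.
have [Pi|nPi] := boolP (P i).
  by under eq_fun do rewrite big_cons Pi; apply: bcontM => //; exact: bF.
by under eq_fun do rewrite big_cons (negbTE nPi).
Qed.

Lemma bcont_det D m (M : V -> 'M[R]_m) : (forall i j, bcont D (fun x => M x i j)) ->
  bcont D (fun x => \det (M x)).
Proof.
move=> bM; rewrite /determinant; apply: bcont_sum => s _.
by apply: bcontM; [exact: bcont_cst|apply: bcont_prod => i; exact: bM].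
Qed.

Lemma bcont_adj D m (M : V -> 'M[R]_m) i j :
  (forall i j, bcont D (fun x => M x i j)) ->
  bcont D (fun x => (\adj (M x)) i j).
Proof.
move=> bM; under eq_fun do rewrite mxE /cofactor.
apply: bcontM; first exact: bcont_cst.
apply: bcont_det => k l.
by under eq_fun do rewrite !mxE; exact: bM.
Qed.

(** A left kernel vector would be isotropic. *)
Lemma positive_definite_unit (A : 'M[R]_n) : positive_definite A -> A \in unitmx.
Proof.
move=> [_ Apos]; rewrite unitmxE unitfE; apply/negP => /det0P[v v0 vA].
by have := Apos v v0; rewrite vA mul0mx mxE ltxx.
Qed.

Lemma bcont_unif (D : set V) (F : 'I_n -> V -> R) : (forall i, bcont D (F i)) ->
  exists2 M, 0 <= M & forall i x, D x -> `|F i x| <= M.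
Proof.
move=> bF; have [_ [M HM]] : bcont D (fun x => \sum_i `|F i x|).
  by apply: bcont_sum => i _; exact: bcont_norm.
exists `|M| => // i x Dx; apply: le_trans (ler_norm _).
apply: le_trans (HM x Dx); apply: le_trans (ler_norm _).
by rewrite (bigD1 i)//= lerDl sumr_ge0.
Qed.

End Regular.

Section Green.
Context (R : realType) (n : nat).
Local Notation V := 'rV[R]_n.
Local Notation e_ i := (delta_mx 0 i : V).
Variables (D : set V) (a : V -> 'M[R]_n) (b : V -> V) (Q : V -> R) (alpha : R)
  (mu : probability (euc R n) R).
Hypotheses (oD : open D) (bD : bounded_set D)
  (hab : elliptic_coefficients alpha a b)
  (hQ : drift_potential D a b Q) (hmu : reversible_measure D Q mu).
Implicit Types f g w u : V -> R.

Lemma C1b_a i j : C1b D (fun x => a x i j) (fun k => partial k (fun x => a x i j)).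
Proof. by have [_ aC _] := hab; exact: C_hoelder2_C1b (aC i j). Qed.

Lemma bcont_a i j : bcont D (fun x => a x i j).
Proof. by have [] := C1b_a i j. Qed.

Lemma bcont_b i : bcont D (fun x => b x 0 i).
Proof. by have [_ _ bC] := hab; have [cb _] := bC i; exact: bcont_continuous. Qed.

Lemma a_sym x i j : a x i j = a x j i.
Proof. by have [/(_ x)[aT _] _ _] := hab; rewrite -{1}aT mxE. Qed.

Lemma derive_Q i x : D x -> is_derive x (e_ i) Q (partial i Q x).
Proof. by move=> /hQ[dQ _]; apply: derivableP; exact: diff_derivable. Qed.

Lemma continuous_Q x : D x -> {for x, continuous Q}.
Proof. by move=> /hQ[dQ _]; exact: differentiable_continuous. Qed.

(** Since [a] is invertible, [b = a grad Q] makes [grad Q] as regular as [a]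
    and [b]. *)
Lemma continuous_partial_Q i x : D x -> {for x, continuous (partial i Q)}.
Proof.
have [apos _ _] := hab.
have E y : D y -> (\det (a y))^-1 * (\sum_j (\adj (a y)) i j * b y 0 j) =
    partial i Q y.
  move=> Dy; have [_ bE] := hQ Dy.
  pose q : 'cV[R]_n := \col_k partial k Q y.
  have bq : (b y)^T = a y *m q.
    apply/colP => j; rewrite !mxE bE; apply: eq_bigr => k _.
    by rewrite mxE.
  have := mul_adj_mx (a y) => /(congr1 (fun M => M *m q)).
  rewrite -mulmxA -bq mul_scalar_mx => /(congr1 (fun M : 'cV[R]_n => M i 0)).
  rewrite [LHS]mxE [RHS]mxE [q i 0]mxE => h.
  have -> : \sum_j (\adj (a y)) i j * b y 0 j = \det (a y) * partial i Q y.
    by rewrite -h; apply: eq_bigr => j _; rewrite [(b y)^T _ _]mxE.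
  rewrite mulKf//; have := positive_definite_unit (apos y).
  by rewrite unitmxE unitfE.
move=> Dx; apply: near_eq_continuous; first exact: (open_near oD Dx E).
have [cs _] : bcont D (fun y => \sum_j (\adj (a y)) i j * b y 0 j).
  apply: bcont_sum => j _; apply: bcontM; last exact: bcont_b.
  exact/bcont_adj/bcont_a.
have [cd _] : bcont D (fun y => \det (a y)) by exact/bcont_det/bcont_a.
apply: continuousM; last exact: cs.
apply: continuousV; last exact: cd.
by have := positive_definite_unit (apos x); rewrite unitmxE unitfE.
Qed.

Lemma measurable_weight :
  measurable_fun (D : set (euc R n)) (fun x => expR (2 * Q x)).
Proof.
apply: continuous_measurable_euc => // x Dx.
apply: (@continuous_comp _ _ _ (fun x => 2 * Q x) expR).
  by apply: continuousM; [exact: cst_continuous|exact: continuous_Q].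
exact: continuous_expR.
Qed.

Lemma integral_reversible f : bcont D f ->
  (leb R n).-integrable (D : set (euc R n)) (fun x => (f x * expR (2 * Q x))%:E) /\
  (\int[mu]_(x in D) (f x)%:E =
   \int[leb R n]_(x in D) (f x * expR (2 * Q x))%:E)%E.
Proof.
move=> bf; apply: (@integral_density _ _ _ (leb R n) mu).
- exact: open_measurable_euc.
- exact: measurable_weight.
- by move=> x _; exact: expR_ge0.
- exact: hmu.
- by have := @bcont_fin_integrable _ _ mu D oD f bf.
Qed.

Lemma mu_D : mu (D : set (euc R n)) = 1%E.
Proof.
rewrite -(@probability_setT _ _ _ mu) !hmu ?setTI ?setIid//.
exact: open_measurable_euc.
Qed.

(** The density [exp(2Q)] is positive and Lebesgue measure charges open sets. *)
Lemma mu_open_gt0 (U : set V) : open U -> U `<=` D -> U !=set0 ->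
  (0 < mu (U : set (euc R n)))%E.
Proof.
move=> oU UD U0; have mU := open_measurable_euc oU.
rewrite hmu// setIidl// lt0e integral_ge0 ?andbT; last first.
  by move=> x _; rewrite lee_fin expR_ge0.
apply/eqP => I0.
have mw := measurable_funS (open_measurable_euc oD) UD measurable_weight.
have : ae_eq (leb R n) (U : set (euc R n)) (fun x => (expR (2 * Q x))%:E) (cst 0%E).
  apply/(ae_eq_integral_abs _ mU); first exact/measurable_EFinP.
  rewrite -[RHS]I0; apply: eq_integral => x _.
  by rewrite gee0_abs// lee_fin expR_ge0.
move=> [N [mN N0 UN]].
have : (leb R n (U : set (euc R n)) <= leb R n N)%E.
  apply: le_measure; rewrite ?inE// => x Ux; apply: UN => /= /(_ Ux)[].
  by apply/eqP; rewrite gt_eqF// expR_gt0.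
by rewrite N0 leNgt leb_open_gt0.
Qed.

(** The components of [a grad u]. *)
Definition flux u (i : 'I_n) : V -> R := fun y => \sum_j a y i j * partial j u y.

Lemma C1b_flux u i : C2b D u -> C1b D (flux u i) (fun k => partial k (flux u i)).
Proof.
move=> [_ u2].
have [df Hdf] : exists df, C1b D (flux u i) df; last exact: C1b_partial Hdf.
rewrite /flux; elim: (index_enum _) => [|j r [df IH]].
  by exists (fun _ _ => 0); under eq_fun do rewrite big_nil; exact: C1b_cst.
eexists; under eq_fun do rewrite big_cons.
by apply: C1bD IH; apply: C1bM; [exact: C1b_a|exact: u2].
Qed.

End Green.

(** * Green's identity for compactly supported test functions *)

Section GreenIdentity.
Context (R : realType) (n : nat).
Local Notation V := 'rV[R]_n.
Local Notation e_ i := (delta_mx 0 i : V).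
Variables (D : set V) (a : V -> 'M[R]_n) (b : V -> V) (Q : V -> R) (alpha : R)
  (mu : probability (euc R n) R).
Hypotheses (oD : open D) (bD : bounded_set D)
  (hab : elliptic_coefficients alpha a b)
  (hQ : drift_potential D a b Q) (hmu : reversible_measure D Q mu).
Implicit Types f g w u : V -> R.

Lemma opL_flux u x : opL a b u x =
  2^-1 * (\sum_i partial i (flux a u i) x) + \sum_i b x 0 i * partial i u x.
Proof. by []. Qed.

Lemma bcont_opL u : C2b D u -> bcont D (opL a b u).
Proof.
move=> u2; apply: bcontD.
  apply: bcontZ; apply: bcont_sum => i _.
  by have [_ /(_ i)[]] := C1b_flux oD bD hab i u2.
apply: bcont_sum => i _; apply: bcontM; first exact: (bcont_b oD bD hab).
by have [[_ /(_ i)[]]] := u2.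
Qed.

(** Symmetry of [a] turns [b . grad u = (a grad Q) . grad u] into
    [grad Q . (a grad u)]. *)
Lemma drift_flux u x : D x ->
  \sum_i b x 0 i * partial i u x = \sum_i partial i Q x * flux a u i x.
Proof.
move=> Dx; have [_ bE] := hQ Dx.
under eq_bigr do rewrite bE mulr_suml.
rewrite exchange_big /=; apply: eq_bigr => j _.
rewrite /flux mulr_sumr; apply: eq_bigr => i _.
by rewrite (a_sym hab x i j); ring.
Qed.

Lemma derive_weight i x : D x ->
  is_derive x (e_ i) (fun y => expR (2 * Q y))
    (expR (2 * Q x) * (2 * partial i Q x)).
Proof.
move=> Dx; have dQ := derive_Q hQ i Dx.
have d2Q : is_derive x (e_ i) (fun y => 2 * Q y) (2 * partial i Q x).
  exact: (is_deriveZ 2 dQ).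
exact: is_derive_compose (is_derive_expR _) d2Q.
Qed.

(** The field [exp(2Q) chi a grad u] has divergence
    [exp(2Q) (2 chi L u + grad chi . a grad u)], because [a grad Q = b]. *)
Lemma green_compact u chi dchi K : C2b D u -> C1b D chi dchi ->
  closed K -> K `<=` D -> (forall x, D x -> ~ K x -> chi x = 0) ->
  (\int[mu]_(x in D)
     (2 * (chi x * opL a b u x) + \sum_i dchi i x * flux a u i x) = 0)%R.
Proof.
move=> u2 [bchi Hchi] cK KD chi0.
have A1 i := C1b_flux oD bD hab i u2.
pose W i x := chi x * flux a u i x * expR (2 * Q x).
pose dW i x := (dchi i x * flux a u i x + chi x * partial i (flux a u i) x +
   chi x * flux a u i x * (2 * partial i Q x)) * expR (2 * Q x).
have cE x : D x -> {for x, continuous (fun x => expR (2 * Q x))}.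
  move=> Dx; apply: (@continuous_comp _ _ _ (fun x => 2 * Q x) expR).
    apply: continuousM; first exact: cst_continuous.
    exact: (continuous_Q hQ).
  exact: continuous_expR.
have dWP i x : D x -> is_derive x (e_ i) (W i) (dW i x).
  move=> Dx; have [_ /(_ i)[/(_ x Dx) dA _]] := A1 i.
  have [/(_ x Dx) dc _] := Hchi i.
  have H := is_deriveM (is_deriveM dc dA) (derive_weight i Dx).
  apply: (@is_derive_eq _ _ _ _ _ _ _ _ H).
  have -> : (chi * flux a u i) x = chi x * flux a u i x by [].
  by rewrite /dW /GRing.scale /=; ring.
have cdW i x : D x -> {for x, continuous (dW i)}.
  move=> Dx; have [[cA _] /(_ i)[_ [cdA _]]] := A1 i.
  have [_ [cdc _]] := Hchi i; have [cc _] := bchi.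
  apply: continuousM; last exact: cE.
  apply: continuousD; first apply: continuousD.
  - by apply: continuousM; [exact: cdc|exact: cA].
  - by apply: continuousM; [exact: cc|exact: cdA].
  apply: continuousM; first by apply: continuousM; [exact: cc|exact: cA].
  apply: continuousM; first exact: cst_continuous.
  exact: (continuous_partial_Q oD bD hab hQ).
have W0 i x : D x -> ~ K x -> W i x = 0.
  by move=> Dx Kx; rewrite /W chi0// !mul0r.
have [_ I0] := integral_divergence_eq0 oD bD cK KD dWP cdW W0.
have bI : bcont D (fun x =>
    2 * (chi x * opL a b u x) + \sum_i dchi i x * flux a u i x).
  apply: bcontD; first by apply: bcontZ; apply: bcontM => //; exact: bcont_opL.
  apply: bcont_sum => i _; apply: bcontM; first by have [] := Hchi i.
  by have [] := A1 i.
have [_ E] := integral_reversible oD hQ hmu bI.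
rewrite /Rintegral E -[RHS]/(fine 0%E) -I0; congr fine.
apply: eq_integral => x /[!inE] Dx; congr (_%:E).
rewrite /dW -mulr_suml; congr (_ * _).
rewrite opL_flux drift_flux// !big_split /= -!mulr_sumr.
have -> : \sum_i chi x * flux a u i x * (2 * partial i Q x) =
    2 * chi x * \sum_i partial i Q x * flux a u i x.
  by rewrite mulr_sumr; apply: eq_bigr => i _; ring.
set S := \sum_i partial i Q x * _; set S' := \sum_i partial i (flux _ _ _) x.
set S'' := \sum_i dchi i x * _.
by field.
Qed.

End GreenIdentity.

(** * Green's identity for test functions vanishing on the boundary *)

Section GreenBoundary.
Context (R : realType) (n : nat).
Local Notation V := 'rV[R]_n.
Local Notation e_ i := (delta_mx 0 i : V).

(** Squaring makes the positive part continuously differentiable at 0. *)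
Lemma is_derive_sqr_pos (t : R) :
  is_derive t (1 : R) (fun s : R => Num.max s 0 ^+ 2) (2 * Num.max t 0).
Proof.
have [t0|t0|->] := ltgtP t 0.
- rewrite mulr0; have K : is_derive t (1 : R) (cst (0 : R)) 0.
    exact: is_derive_cst.
  apply: near_eq_is_derive K.
  apply: filterS (open_nbhs_nbhs (conj (@open_lt R 0) t0)) => s /= s0.
  by rewrite max_r ?expr0n// ltW.
- have K : is_derive t (1 : R) (fun s : R => s ^+ 2) (2 * t).
    have H := @is_deriveM R R id id t 1 1 1 (is_derive_id _ _) (is_derive_id _ _).
    apply: (@is_derive_eq _ _ _ _ _ _ _ _ H).
    by rewrite /GRing.scale /= mulr1 mulr_natl.
  apply: near_eq_is_derive K.
  apply: filterS (open_nbhs_nbhs (conj (@open_gt R 0) t0)) => s /= s0.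
  by rewrite max_l// ltW.
rewrite mulr0.
have c : (fun h : R => h^-1 *: ((fun s : R => Num.max s 0 ^+ 2) (h *: (1 : R) + 0)
     - (fun s : R => Num.max s 0 ^+ 2) 0)) @ 0^' --> (0 : R).
  apply/cvgrPdist_lt => e e0; rewrite near_withinE; near=> h => h0.
  rewrite addr0 [h *: 1]mulr1 maxxx expr0n subr0 sub0r normrN.
  have [hp|hn] := ltP 0 h; last by rewrite expr0n scaler0 normr0.
  rewrite /GRing.scale /= expr2 mulrA mulVf// mul1r.
  rewrite -[h]subr0 distrC; near: h.
  by move: e e0; apply/cvgrPdist_lt; exact: cvg_id.
split; first by apply/cvg_ex; exists 0.
exact/cvg_lim/c.
Unshelve. all: by end_near. Qed.

Lemma bcont_pos (D : set V) f : bcont D f -> bcont D (fun x => Num.max (f x) 0).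
Proof.
move=> [cf [M fM]]; split.
  move=> x Dx; apply: (@continuous_comp _ _ _ f (fun t : R => Num.max t 0)).
    exact: cf.
  by move=> t; apply: continuous_max; [exact: cvg_id|exact: cst_continuous].
exists M => x Dx; apply: le_trans (fM x Dx).
by have [h|h] := leP (f x) 0; rewrite ?normr0.
Qed.

Lemma C1b_sqr_pos (D : set V) f df : C1b D f df ->
  C1b D (fun x => Num.max (f x) 0 ^+ 2)
        (fun i x => 2 * Num.max (f x) 0 * df i x).
Proof.
move=> [bf Hf]; have bp := bcont_pos bf; split; first exact: bcontX.
move=> i; have [dfi bdfi] := Hf i; split; last first.
  by apply: bcontM => //; exact: bcontZ.
move=> x Dx; exact: is_derive_compose (is_derive_sqr_pos _) (dfi x Dx).
Qed.

Variables (D : set V) (a : V -> 'M[R]_n) (b : V -> V) (Q : V -> R) (alpha : R)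
  (mu : probability (euc R n) R).
Hypotheses (oD : open D) (bD : bounded_set D)
  (hab : elliptic_coefficients alpha a b)
  (hQ : drift_potential D a b Q) (hmu : reversible_measure D Q mu).
Implicit Types f g w u : V -> R.

(** The profile [1 - H] of the cutoff, where [H] is a C^1 function that vanishes
    on [r <= 1] and tends to 1 at infinity. *)
Definition cut (r : R) : R := (1 + Num.max (r - 1) 0 ^+ 2)^-1.

Lemma cut_ge0 r : 0 <= cut r.
Proof. by rewrite invr_ge0 addr_ge0// sqr_ge0. Qed.

Lemma cut_le1 r : cut r <= 1.
Proof. by rewrite invf_le1 ?lerDl ?sqr_ge0// ltr_pwDl// sqr_ge0. Qed.

Lemma cut_bound r : 0 < r -> cut r <= 2 / r.
Proof.
move=> r0; rewrite /cut ler_pdivlMr// mulrC ler_pdivrMr; last first.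
  by rewrite ltr_pwDl// sqr_ge0.
have [h|h] := leP (r - 1) 0; first by rewrite expr0n /=; lra.
by have := sqr_ge0 (r - 5 / 4); rewrite !expr2; lra.
Qed.

(** [r (1 - cut)'(r)] is controlled by [cut r]: this is what makes the error
    terms created by the cutoff negligible. *)
Lemma cut_deriv_bound r : 0 <= r ->
  r * (2 * Num.max (r - 1) 0 * cut r ^+ 2) <= 3 * cut r.
Proof.
move=> r0; have c0 := cut_ge0 r; rewrite expr2 !mulrA ler_wpM2r//.
rewrite /cut ler_pdivrMr; last by rewrite ltr_pwDl// sqr_ge0.
have [h|h] := leP (r - 1) 0; first by rewrite !(mulr0, mul0r) expr0n /=; lra.
by have := sqr_ge0 (r - 2); rewrite !expr2; lra.
Qed.

(** Green's first identity for a test function [w] that vanishes on the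
    boundary. The test function is multiplied by [1 - cut (N s)] with
    [s = w^2 + phi^2], which vanishes near the boundary because [s] does, and
    tends to 1 in [D] because [phi > 0] there. The error is at most a constant
    times [cut (N s)], since [|w| |grad s|] is at most a constant times [s]. *)
Lemma green u w dw phi dphi : C2b D u -> C1b D w dw -> C1b D phi dphi ->
  continuous (w \_ D) -> continuous (phi \_ D) ->
  (forall x, D x -> 0 < phi x) ->
  (\int[mu]_(x in D)
     (2 * (w x * opL a b u x) + \sum_i dw i x * flux a u i x) = 0)%R.
Proof.
move=> u2 w1 phi1 cw cphi phi0.
have A1 i := C1b_flux oD bD hab i u2.
have bL := bcont_opL oD bD hab u2.
pose s x := w x * w x + phi x * phi x.
pose ds i x := (dw i x * w x + w x * dw i x) +
               (dphi i x * phi x + phi x * dphi i x).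
have s1 : C1b D s ds by apply: C1bD; exact: C1bM.
have s0 x : D x -> 0 < s x.
  by move=> /phi0 p0; rewrite /s -!expr2 ltr_wpDl ?sqr_ge0// exprn_gt0.
pose c N x := cut (N%:R * s x).
pose dc N i x := - (cut (N%:R * s x) ^+ 2) *
  (2 * Num.max (N%:R * s x - 1) 0 * (N%:R * ds i x)).
have c1 N : C1b D (c N) (dc N).
  have h1 : C1b D (fun x => N%:R * s x - 1) (fun i x => N%:R * ds i x).
    have := C1bD (C1bM (C1b_cst D N%:R) s1) (C1b_cst D (- 1)).
    congr C1b; apply/funext => i; apply/funext => x.
    by rewrite mul0r add0r addr0.
  have h2 := C1bD (C1b_cst D 1) (C1b_sqr_pos h1).
  have h3 x : D x -> 1 <= 1 + Num.max (N%:R * s x - 1) 0 ^+ 2.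
    by rewrite lerDl sqr_ge0.
  have := C1bV ltr01 h3 h2; congr C1b.
  by apply/funext => i; apply/funext => x; rewrite add0r.
pose chi N x := w x * (1 - c N x).
pose dchi N i x := dw i x * (1 - c N x) - w x * dc N i x.
have chi1 N : C1b D (chi N) (dchi N).
  have h1 : C1b D (fun x => 1 - c N x) (fun i x => - dc N i x).
    have := C1bD (C1b_cst D 1) (C1bM (C1b_cst D (- 1)) (c1 N)).
    congr C1b; first by apply/funext => x; rewrite mulN1r.
    apply/funext => i; apply/funext => x.
    by rewrite mul0r !add0r mulN1r.
  have := C1bM w1 h1; congr C1b.
  by apply/funext => i; apply/funext => x; rewrite mulrN.
have cs : continuous (s \_ D).
  rewrite (_ : s \_ D = (w \_ D) \* (w \_ D) \+ (phi \_ D) \* (phi \_ D)).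
    move=> x; apply: continuousD; apply: continuousM;
      [exact: cw|exact: cw|exact: cphi|exact: cphi].
  apply/funext => x /=; rewrite !patchE; case: ifPn => //.
  by rewrite mulr0 addr0.
(* [chi N] vanishes where [N s < 1], and [s] extends by zero continuously. *)
have I0 N : (\int[mu]_(x in D) (2 * (chi N x * opL a b u x) +
    \sum_i dchi N i x * flux a u i x) = 0)%R.
  pose K := [set x | 1 <= N%:R * (s \_ D) x].
  apply: (green_compact oD bD hab hQ hmu (K := K)) => //.
  - have /continuous_closedP h : continuous (fun x : V => N%:R * (s \_ D) x : R).
      move=> x; apply: (@continuousM R V (fun=> N%:R) (s \_ D)).
        exact: cst_continuous.
      exact: cs.
    exact: (h _ (@closed_ge R 1)).
  - move=> x; rewrite /K /= patchE; case: ifPn => [/[!inE]//|_].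
    by rewrite mulr0 ler10.
  - move=> x Dx; rewrite /K /= patchE mem_set// => /negP; rewrite -ltNge => sx.
    rewrite /chi /c /cut max_r; last by rewrite subr_le0 ltW.
    by rewrite expr0n addr0 invr1 subrr mulr0.
have [bw Hw] := w1; have [bp Hp] := phi1.
have [M1 M10 dwM] := bcont_unif (fun i => (Hw i).2).
have [M2 M20 dpM] := bcont_unif (fun i => (Hp i).2).
have [M3 M30 AM] := bcont_unif (fun i => (A1 i).1).
have [_ [M4 LM]] := bcontM bw bL.
pose M := M1 + M2.
(* [|w| |grad s|] is quadratic in [w] and [phi], as [s] is. *)
have wds i x : D x -> `|w x * ds i x| <= 4 * M * s x.
  move=> Dx; have h1 := dwM i x Dx; have h2 := dpM i x Dx.
  rewrite /s /ds -[w x * w x]expr2 -[phi x * phi x]expr2.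
  rewrite -[w x ^+ 2]real_normK ?num_real// -[phi x ^+ 2]real_normK ?num_real//.
  have -> : w x * (dw i x * w x + w x * dw i x +
      (dphi i x * phi x + phi x * dphi i x)) =
      2 * (w x ^+ 2 * dw i x) + 2 * (w x * phi x * dphi i x) by ring.
  apply: (le_trans (ler_normD _ _)); rewrite !normrM normr_nat.
  move: (normr_ge0 (w x)) (normr_ge0 (phi x)) (normr_ge0 (dw i x))
    (normr_ge0 (dphi i x)) h1 h2; move: `|w x| `|phi x| `|dw i x| `|dphi i x|.
  move=> p q r t p0 q0 r0 t0 h1 h2.
  have k1 : p ^+ 2 * r <= p ^+ 2 * M1 by rewrite ler_wpM2l// sqr_ge0.
  have k2 : p * q * t <= p * q * M2 by rewrite ler_wpM2l// mulr_ge0.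
  have k3 : p * q * M2 <= (p ^+ 2 + q ^+ 2) / 2 * M2.
    by rewrite ler_wpM2r//; have := sqr_ge0 (p - q); nra.
  have k4 : 0 <= p ^+ 2 * M2 by rewrite mulr_ge0// sqr_ge0.
  have k5 : 0 <= q ^+ 2 * M2 by rewrite mulr_ge0// sqr_ge0.
  have k6 : 0 <= q ^+ 2 * M1 by rewrite mulr_ge0// sqr_ge0.
  have k7 : 0 <= p ^+ 2 * M1 by rewrite mulr_ge0// sqr_ge0.
  rewrite /M; nra.
have wdc N i x : D x -> `|w x * dc N i x| <= 12 * M * c N x.
  move=> Dx; set r := N%:R * s x.
  have r0 : 0 <= r by rewrite mulr_ge0// ltW// s0.
  have m0 : 0 <= Num.max (r - 1) 0 by rewrite le_max lexx orbT.
  have -> : w x * dc N i x = - (N%:R * (2 * Num.max (r - 1) 0 * cut r ^+ 2) *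
      (w x * ds i x)) by rewrite /dc -/r; ring.
  rewrite normrN normrM ger0_norm; last first.
    by rewrite !mulr_ge0// ?cut_ge0.
  apply: (@le_trans _ _ (N%:R * (2 * Num.max (r - 1) 0 * cut r ^+ 2) *
    (4 * M * s x))).
    by rewrite ler_wpM2l ?wds// !mulr_ge0// ?cut_ge0.
  have -> : N%:R * (2 * Num.max (r - 1) 0 * cut r ^+ 2) * (4 * M * s x) =
    4 * M * (r * (2 * Num.max (r - 1) 0 * cut r ^+ 2)) by rewrite /r; ring.
  have -> : 12 * M * c N x = 4 * M * (3 * cut r) by rewrite /c -/r; ring.
  by rewrite ler_wpM2l ?cut_deriv_bound// mulr_ge0// addr_ge0.
(* [C] bounds the coefficients of [c N] in the difference of the integrands. *)
pose I x := 2 * (w x * opL a b u x) + \sum_i dw i x * flux a u i x.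
pose C := 2 * `|M4| + \sum_(i < n) (M1 * M3 + 12 * M * M3).
have bI : bcont D I.
  apply: bcontD; first by apply: bcontZ; exact: bcontM.
  apply: bcont_sum => i _; apply: bcontM; first by have [] := Hw i.
  by have [] := A1 i.
pose IN N x := 2 * (chi N x * opL a b u x) + \sum_i dchi N i x * flux a u i x.
have bIN N : bcont D (IN N).
  have [bchi Hchi] := chi1 N.
  apply: bcontD; first by apply: bcontZ; exact: bcontM.
  apply: bcont_sum => i _; apply: bcontM; first by have [] := Hchi i.
  by have [] := A1 i.
have diff N x : D x -> `|I x - IN N x| <= C * c N x.
  move=> Dx; have k0 : 0 <= c N x by exact: cut_ge0.
  have -> : I x - IN N x = 2 * (w x * opL a b u x) * c N x +
      \sum_i (dw i x * c N x + w x * dc N i x) * flux a u i x.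
    rewrite /I /IN opprD addrACA -sumrB; congr (_ + _).
      by rewrite /chi; ring.
    by apply: eq_bigr => i _; rewrite /dchi; ring.
  apply: (le_trans (ler_normD _ _)); rewrite /C [leRHS]mulrDl; apply: lerD.
    rewrite !normrM normr_nat (ger0_norm k0) ler_wpM2r// ler_wpM2l//.
    by rewrite -normrM (le_trans (LM x Dx))// ler_norm.
  apply: (le_trans (ler_norm_sum _ _ _)); rewrite mulr_suml.
  apply: ler_sum => i _; rewrite [leRHS]mulrDl normrM.
  have -> : M1 * M3 * c N x + 12 * M * M3 * c N x =
    (M1 * c N x + 12 * M * c N x) * M3 by ring.
  apply: ler_pM => //; last exact: AM.
  apply: (le_trans (ler_normD _ _)); apply: lerD; last exact: wdc.
  by rewrite normrM (ger0_norm k0) ler_wpM2r// dwM.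
have cc : (fun N => \int[mu]_(x in D) c N x)%R @ \oo -->
    (\int[mu]_(x in D) (0 : R))%R.
  apply: (@dominated_Rintegral _ _ mu D oD c (fun=> 0) 1).
  - by move=> N; have [] := c1 N.
  - exact: bcont_cst.
  - move=> x Dx; have sx := s0 x Dx.
    apply/cvgrPdist_lt => e e0; near=> N.
    have N0 : 2 / (s x * e) < N%:R by near: N; exact: nbhs_infty_gtr.
    have Np : 0 < N%:R :> R by apply: lt_trans N0; rewrite divr_gt0// mulr_gt0.
    rewrite sub0r normrN ger0_norm ?cut_ge0//.
    apply: (le_lt_trans (cut_bound _)); first by rewrite mulr_gt0.
    rewrite ltr_pdivrMr ?mulr_gt0//; move: N0.
    by rewrite ltr_pdivrMr ?mulr_gt0// => N0; rewrite mulrCA [e * _]mulrC.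
  - by move=> N x Dx; rewrite ger0_norm ?cut_le1 ?cut_ge0.
have Rint0 : (\int[mu]_(x in D) (0 : R))%R = 0 :> R.
  by rewrite /Rintegral integral0.
rewrite Rint0 in cc.
have le N : `|\int[mu]_(x in D) I x|%R <= C * (\int[mu]_(x in D) c N x)%R.
  have [bc _] := c1 N.
  rewrite -(RintegralZ_bcont mu oD C bc) -[X in `|X|]subr0 -(I0 N).
  rewrite -(RintegralB_bcont mu oD bI (bIN N)).
  apply: (ler_norm_Rintegral_bcont mu oD (bcontB bI (bIN N)) (bcontZ _ bc)).
  exact: diff.
apply/eqP; rewrite -normr_le0.
have cC : (fun N => C * (\int[mu]_(x in D) c N x)%R) @ \oo --> C * 0.
  exact: cvgMr.
rewrite mulr0 in cC.
have h : `|\int[mu]_(x in D) I x|%R <=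
    limn (fun N => C * (\int[mu]_(x in D) c N x)%R).
  by apply: limr_ge; [apply/cvg_ex; exists 0|exact: nearW].
by rewrite (cvg_lim _ cC) in h.
Unshelve. all: by end_near. Qed.

End GreenBoundary.

(** * Extension by zero, and functions with zero gradient *)

Section Domain.
Context (R : realType) (n : nat).
Local Notation V := 'rV[R]_n.
Local Notation e_ i := (delta_mx 0 i : V).
Implicit Types (D : set V) (f : V -> R).

Lemma restrict_continuous D f : open D -> {within closure D, continuous f} ->
  (forall x, boundary D x -> f x = 0) -> continuous (f \_ D).
Proof.
move=> oD cfD f0 x; have /subspace_continuousP cf := cfD.
have [Dx|Dx] := pselect (D x).
  apply: (@near_eq_continuous _ _ f).
    by apply: (open_near oD Dx) => y Dy; rewrite patchE mem_set.
  have := continuous_subspaceW (@subset_closure _ D) cfD.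
  by rewrite continuous_open_subspace// => /(_ x); apply; rewrite inE.
have [cDx|cDx] := pselect (closure D x); last first.
  apply: (@near_eq_continuous _ _ (fun=> 0)); last exact: cst_continuous.
  apply: (open_near (D := ~` closure D)) => //.
    exact/closed_openC/closed_closure.
  move=> y cDy; rewrite patchE memNset// => Dy.
  by apply: cDy; exact: subset_closure.
have fx : f x = 0.
  by apply: f0; split => //; rewrite (iffLR (interior_id D) oD).
rewrite /continuous_at patchE memNset//.
have nf : Filter (nbhs x) by exact: nbhs_filter.
have wf : Filter (within (closure D) (nbhs x)) by exact: within_filter.
apply: (iffRL (@cvgrPdist_lt _ _ _ (nbhs x) nf (f \_ D) 0)) => e e0.
have := iffLR (@cvgrPdist_lt _ _ _ _ wf f (f x)) (cf x cDx) e e0.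
rewrite near_withinE fx => h.
apply: (@filterS _ _ nf _ _ _ h) => y {}h.
rewrite patchE; case: ifPn => [/[!inE] Dy|_]; last by rewrite subrr normr0.
by apply: h; exact: subset_closure.
Qed.

(** Change the coordinates one at a time: the balls of the sup norm are boxes, so
    the intermediate segments stay in the ball. *)
Lemma ball_zero_gradient_cst (x y : V) r f : ball x r y ->
  (forall z i, ball x r z -> is_derive z (e_ i) f 0) -> f y = f x.
Proof.
move=> xy df.
(* the first [k] coordinates are those of [y] already *)
pose z k : V := \row_j if (j < k)%N then y 0 j else x 0 j.
suff E k : (k <= n)%N -> f (z k) = f x.
  rewrite -(E n)//; congr f; apply/rowP => j.
  by rewrite mxE ltn_ord.
elim: k => [_|k IH kn].
  by congr f; apply/rowP => j; rewrite mxE.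
rewrite -IH ?(ltnW kn)//.
pose i := Ordinal kn; pose d := y 0 i - x 0 i.
have zS t : t *: (e_ i) + z k = \row_j if (j < k)%N then y 0 j else
    if j == i then x 0 j + t else x 0 j.
  apply/rowP => j; rewrite !mxE eqxx /= eq_sym.
  have [->|ji] := eqVneq j i; first by rewrite ltnn mulr1 addrC.
  by rewrite mulr0 add0r.
have z1 : z k.+1 = d *: (e_ i) + z k.
  rewrite zS; apply/rowP => j; rewrite !mxE ltnS leq_eqVlt.
  have [->|ji] := eqVneq j i; first by rewrite eqxx ltnn /d /= addrC subrK.
  by rewrite -[val j == k]/(j == i) (negbTE ji).
have z0 : z k = 0 *: (e_ i) + z k by rewrite scale0r add0r.
have xyj j : `|x 0 j - y 0 j| < r by have [_] := xy; move/(_ 0 j).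
have r0 : 0 < r by have [] := xy.
pose lo := Num.min 0 d; pose hi := Num.max 0 d.
have lohi : lo <= hi by rewrite /lo /hi; case: (leP 0 d) => // /ltW.
have zB t : t \in `[lo, hi] -> ball x r (t *: (e_ i) + z k).
  move=> tlh; split => // i' j; rewrite ord1 zS mxE.
  case: ifPn => _; first exact: xyj.
  case: ifPn => [/eqP ->|_]; last by rewrite /ball /= subrr normr0.
  rewrite /ball /= opprD addrA subrr sub0r normrN.
  apply: le_lt_trans (xyj i); rewrite distrC -/d.
  move: tlh; rewrite in_itv /= /lo /hi.
  case: (leP 0 d) => d0 /andP[t1 t2].
    by rewrite !ger0_norm.
  by rewrite (ltr0_norm d0) ler0_norm// lerN2.
pose g (t : R) := f (t *: (e_ i) + z k).
have dg (t : R) : t \in `[lo, hi] -> is_derive t (1 : R) g 0.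
  move=> /zB tB.
  have H (h : R) : f (h *: e_ i + (t *: (e_ i) + z k)) = g (h *: (1 : R) + t).
    by rewrite /g addrA -scalerDl [h *: 1]mulr1.
  exact: (@is_derive_along R V R f g _ _ t 1 _ H (df _ i tB)).
have cg : {within `[lo, hi], continuous g}.
  by apply: derivable_within_continuous => t /dg[].
have [c _] := MVT_segment lohi (fun t h => dg t (subset_itv_oo_cc h)) cg.
rewrite mul0r z1 {2}z0 => /eqP; rewrite subr_eq0 => /eqP.
rewrite -[LHS]/(f (hi *: e_ i + z k)) -[RHS]/(f (lo *: e_ i + z k)).
by rewrite /lo /hi; case: (leP 0 d).
Qed.

(** The level sets are open by the previous lemma, and closed by continuity. *)
Lemma connected_zero_gradient_cst D f : open D -> connected D ->
  (forall x, D x -> {for x, continuous f}) ->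
  (forall x i, D x -> is_derive x (e_ i) f 0) ->
  forall x y, D x -> D y -> f x = f y.
Proof.
move=> oD conD cf df x y Dx Dy.
pose B := [set z | D z /\ f z = f x].
have oB : open B.
  rewrite openE => z [Dz fz]; have /nbhs_ballP[r /= r0 zr] : nbhs z D.
    by exact: open_nbhs_nbhs.
  apply/nbhs_ballP; exists r => //= y' zy'; split; first exact: zr.
  rewrite -fz; apply: (ball_zero_gradient_cst zy') => w i zw.
  exact/df/zr.
have oC : open [set z | D z /\ f z != f x].
  rewrite openE => z [Dz fz]; rewrite /interior.
  have nf : Filter (nbhs z) by exact: nbhs_filter.
  apply: (@filterI _ _ nf); first exact: open_nbhs_nbhs.
  apply: (cf z Dz (fun t => t != f x)).
  by apply: open_nbhs_nbhs; split => //; exact: open_neq.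
have BD : B = D.
  apply: conD; first by exists x.
    by exists B => //; apply/seteqP; split => z [] // ? ?; split.
  exists (~` [set z | D z /\ f z != f x]); first exact: open_closedC.
  apply/seteqP; split => z.
    by move=> [Dz fz]; split => // -[_]; rewrite fz eqxx.
  move=> [Dz h]; split => //; apply/eqP; apply: contrapT => /negP fz.
  by apply: h.
by have : B y by [rewrite BD]; case=> _ ->.
Qed.

End Domain.

(** * Symmetry and negativity of the Dirichlet operator *)

Section Form.
Context (R : realType) (n : nat).
Implicit Types (A : 'M[R]_n) (p q : 'I_n -> R).

Definition form A p q : R := \sum_i p i * \sum_j A i j * q j.

Lemma formE A p q :
  form A p q = ((\row_i p i) *m A *m (\row_j q j)^T) 0 0.
Proof.
rewrite -mulmxA mxE; apply: eq_bigr => i _; rewrite mxE; congr (_ * _).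
by rewrite mxE; apply: eq_bigr => j _; rewrite !mxE.
Qed.

Lemma form_ge0 A p : positive_definite A -> 0 <= form A p p.
Proof.
move=> [_ Apos]; rewrite formE.
have [->|p0] := eqVneq (\row_i p i) 0; first by rewrite !mul0mx mxE.
exact/ltW/Apos.
Qed.

Lemma form_eq0 A p : positive_definite A -> form A p p = 0 -> forall i, p i = 0.
Proof.
move=> [_ Apos]; rewrite formE => p0 i.
have [|/Apos] := eqVneq (\row_i p i) 0; last by rewrite p0 ltxx.
by move=> /rowP/(_ i); rewrite !mxE.
Qed.

Lemma formC A p q : A^T = A -> form A p q = form A q p.
Proof.
move=> AT; rewrite /form; under eq_bigr do rewrite mulr_sumr.
rewrite exchange_big /=; apply: eq_bigr => j _.
rewrite mulr_sumr; apply: eq_bigr => i _.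
by rewrite -{1}AT mxE; ring.
Qed.

Lemma form_lin A (c d : R) p q r :
  form A (fun i => c * p i + d * q i) r = c * form A p r + d * form A q r.
Proof.
rewrite /form !mulr_sumr -big_split /=; apply: eq_bigr => i _.
by ring.
Qed.

Lemma form_sqr A (c d : R) p q : A^T = A ->
  form A (fun i => c * p i + d * q i) (fun i => c * p i + d * q i) =
  c ^+ 2 * form A p p + 2 * c * d * form A p q + d ^+ 2 * form A q q.
Proof.
move=> AT; set r := fun i => c * p i + d * q i.
rewrite {1}/r form_lin (formC p r AT) (formC q r AT) /r !form_lin.
by rewrite (formC q p AT); ring.
Qed.

End Form.

Section Spectral.
Context (R : realType) (n : nat).
Local Notation V := 'rV[R]_n.+1.
Local Notation e_ i := (delta_mx 0 i : V).
Variables (D : set V) (a : V -> 'M[R]_n.+1) (b : V -> V) (Q : V -> R) (alpha : R)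
  (mu : probability (euc R n.+1) R) (lam : nat -> R) (phi : nat -> V -> R).
Hypotheses (hD : bounded_domain D)
  (hab : elliptic_coefficients alpha a b)
  (hQ : drift_potential D a b Q) (hmu : reversible_measure D Q mu)
  (hphi : dirichlet_eigenbasis a b D mu lam phi).
Implicit Types f g w u : V -> R.

Let oD : open D. Proof. by case: hD. Qed.
Let bD : bounded_set D. Proof. by case: hD. Qed.
Let apos x : positive_definite (a x). Proof. by case: hab. Qed.
Let aT x : (a x)^T = a x. Proof. by case: (apos x). Qed.
Let mu_open U : open U -> U `<=` D -> U !=set0 ->
  (0 < mu (U : set (euc R n.+1)))%E.
Proof. exact: (mu_open_gt0 oD hQ hmu). Qed.

(** The boundary condition is expressed by the continuity of the extension by
    zero, which is the form in which the cutoff in Green's identity uses it. *)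
Definition dirichlet_C2 u := C2b D u /\ continuous (u \_ D).

Lemma dirichlet_C2_bcont u : dirichlet_C2 u -> bcont D u.
Proof. by case=> -[[]]. Qed.

Lemma dirichlet_phi k : dirichlet_C2 (phi k).
Proof.
have [+ _ _ _ _] := hphi => /(_ k)[Ck p0 _]; split; first exact: C_closure_C2b.
by apply: restrict_continuous => //; case: Ck.
Qed.

Lemma bcont_phi k : bcont D (phi k).
Proof. exact/dirichlet_C2_bcont/dirichlet_phi. Qed.

Lemma phi_eigen k x : D x -> opL a b (phi k) x = lam k * phi k x.
Proof. by have [+ _ _ _ _] := hphi => /(_ k)[_ _]; exact. Qed.

Lemma phi0_gt0 x : D x -> 0 < phi 0 x.
Proof. by have [_ _ _ _] := hphi; exact. Qed.

Local Notation grad u x := (fun i => partial i u x).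

(** The eigenfunction [phi 0] serves as the positive function of [green]. *)
Lemma green_dirichlet u w dw : C2b D u -> C1b D w dw -> continuous (w \_ D) ->
  (\int[mu]_(x in D)
     (2 * (w x * opL a b u x) + form (a x) (dw ^~ x) (grad u x)) = 0)%R.
Proof.
move=> u2 w1 cw; have [[p1 _] cp] := dirichlet_phi 0.
exact: (green oD bD hab hQ hmu u2 w1 p1 cw cp phi0_gt0).
Qed.

Lemma bcont_form u dw : C2b D u -> (forall i, bcont D (dw i)) ->
  bcont D (fun x => form (a x) (dw ^~ x) (grad u x)).
Proof.
move=> u2 bw; apply: bcont_sum => i _; apply: bcontM => //.
by have [] := C1b_flux oD bD hab i u2.
Qed.

(** Both sides are minus half of the same energy. *)
Lemma opL_symmetric u w : dirichlet_C2 u -> dirichlet_C2 w ->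
  (\int[mu]_(x in D) (w x * opL a b u x) =
   \int[mu]_(x in D) (u x * opL a b w x))%R.
Proof.
have half u1 u2 : dirichlet_C2 u1 -> dirichlet_C2 u2 ->
  (2 * \int[mu]_(x in D) (u2 x * opL a b u1 x) =
   - \int[mu]_(x in D) form (a x) (grad u2 x) (grad u1 x))%R.
  move=> [uC _] [wC cw]; have [w1 _] := wC; have [bw Hw] := w1.
  have bp : bcont D (fun x => u2 x * opL a b u1 x).
    by apply: bcontM => //; exact: (bcont_opL oD bD hab).
  have bf := bcont_form uC (fun i => (Hw i).2).
  have := green_dirichlet uC w1 cw.
  rewrite (RintegralD_bcont mu oD (bcontZ 2 bp) bf).
  rewrite (RintegralZ_bcont mu oD 2 bp) => /eqP.
  by rewrite addr_eq0 => /eqP.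
have twice (x y z t : R) : 2 * x = - z -> 2 * y = - t -> z = t -> x = y by lra.
move=> hu hw; apply: (twice _ _ _ _ (half _ _ hu hw) (half _ _ hw hu)).
by apply: eq_Rintegral => x _; exact: formC.
Qed.

(** An eigenfunction for a nonnegative eigenvalue would have zero energy, hence
    be constant on [D]; a positive constant on [D] does not extend continuously
    by zero across the boundary. *)
Lemma lam_lt0 k : lam k < 0.
Proof.
have [_ ndl _ _ _] := hphi.
apply: le_lt_trans (ndl 0%N k (leq0n k)) _; rewrite ltNge; apply/negP => l0.
have [p2 cp] := dirichlet_phi 0; have [p1 _] := p2; have [bp Hp] := p1.
pose E x := form (a x) (grad (phi 0) x) (grad (phi 0) x).
have bE : bcont D E by apply: bcont_form => // i; case: (Hp i).
have E0 x : 0 <= E x by exact: form_ge0.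
have Ez x : D x -> E x = 0.
  move=> Dx; apply/eqP; apply: contrapT => /negP Ex.
  pose I y := 2 * (phi 0 y * opL a b (phi 0) y) + E y.
  have l1 y : D y -> 0 <= 2 * (phi 0 y * opL a b (phi 0) y).
    move=> Dy; rewrite phi_eigen//.
    by have := mulr_ge0 l0 (sqr_ge0 (phi 0 y)); rewrite expr2; lra.
  have bI : bcont D I.
    apply: bcontD => //; apply: bcontZ; apply: bcontM => //.
    exact: (bcont_opL oD bD hab).
  have I0 y : D y -> 0 <= I y by move=> /l1 h; exact: addr_ge0.
  have Ix : exists2 y, D y & I y != 0.
    exists x => //; rewrite gt_eqF// ltr_wpDl//; first exact: l1.
    by rewrite lt_neqAle eq_sym Ex E0.
  have := gt0_Rintegral_bcont oD mu_open bI I0 Ix.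
  have := green_dirichlet p2 p1 cp; rewrite -/I => ->.
  by rewrite ltxx.
have [_ conD [x Dx] _] := hD.
have cst : forall y, D y -> phi 0 x = phi 0 y.
  move=> y Dy; apply: (connected_zero_gradient_cst oD conD) => //.
    by case: bp.
  move=> z i Dz; have [dz _] := Hp i; have := dz z Dz.
  by rewrite (form_eq0 (apos z) (Ez z Dz) i).
pose c := phi 0 x; have c0 : 0 < c := phi0_gt0 Dx.
have [M [_ DM]] := bD.
pose T := `|x| + `|M| + 2.
pose g (t : R) := (phi 0 \_ D) (t *: e_ ord0 + x).
have cg : continuous g.
  move=> t; apply: (@continuous_comp R V R (fun t : R => t *: e_ ord0 + x)
    (phi 0 \_ D)); last exact: cp.
  apply: continuousD; last exact: cst_continuous.
  exact: scalel_continuous.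
have T0 : 0 <= T by rewrite !addr_ge0.
have g0 : g 0 = c by rewrite /g scale0r add0r patchE mem_set.
(* at time [T] the line has left the bounded set [D] *)
have gT : g T = 0.
  rewrite /g patchE memNset// => DT.
  have := DM (`|M| + 1) (ltr_pwDr ltr01 (ler_norm _)) _ DT.
  apply/negP; rewrite -ltNge.
  apply: lt_le_trans (lerB_normD _ _); rewrite normrZ ger0_norm//.
  rewrite delta_mx_rv_cons0 norm_rv_cons normr1 normr0 max_l// mulr1.
  by rewrite /T; lra.
have [t _ gt] : exists2 t, t \in `[0, T] & g t = c / 2.
  apply: IVT => //; first exact: continuous_subspaceT.
  rewrite g0 gT min_r ?max_l; [|exact: ltW..].
  by apply/andP; split; lra.
move: gt; rewrite /g patchE; case: ifPn => [/[!inE] Dt|_].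
  by rewrite -(cst _ Dt) -/c; lra.
by move=> h; have : 0 = c / 2 := h; lra.
Qed.

End Spectral.

(** * Simplicity of the principal eigenvalue *)

Section Simplicity.
Context (R : realType) (n : nat).
Local Notation V := 'rV[R]_n.+1.
Local Notation e_ i := (delta_mx 0 i : V).
Variables (D : set V) (a : V -> 'M[R]_n.+1) (b : V -> V) (Q : V -> R) (alpha : R)
  (mu : probability (euc R n.+1) R) (lam : nat -> R) (phi : nat -> V -> R).
Hypotheses (hD : bounded_domain D)
  (hab : elliptic_coefficients alpha a b)
  (hQ : drift_potential D a b Q) (hmu : reversible_measure D Q mu)
  (hphi : dirichlet_eigenbasis a b D mu lam phi).
Implicit Types f g w u : V -> R.

Let oD : open D. Proof. by case: hD. Qed.
Let bD : bounded_set D. Proof. by case: hD. Qed.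
Let apos x : positive_definite (a x). Proof. by case: hab. Qed.
Let aT x : (a x)^T = a x. Proof. by case: (apos x). Qed.
Let mu_open U : open U -> U `<=` D -> U !=set0 ->
  (0 < mu (U : set (euc R n.+1)))%E.
Proof. exact: (mu_open_gt0 oD hQ hmu). Qed.

Local Notation grad u x := (fun i => partial i u x).

(** With [t = u / (v + e)], the second form on the left is that of the gradient
    of [u^2 / (v + e)] against [grad v]: the right side is a square. *)
Lemma picone_identity (A : 'M[R]_n.+1) (p q : 'I_n.+1 -> R) (t : R) : A^T = A ->
  form A p p - form A (fun i => 2 * t * p i + - (t ^+ 2) * q i) q =
  form A (fun i => 1 * p i + - t * q i) (fun i => 1 * p i + - t * q i).
Proof. by move=> AT; rewrite form_sqr// form_lin; ring. Qed.

Variables (k : nat) (hk : lam k = lam 0).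
Let u := phi k.
Let v := phi 0.
(** The energy of [(v + e) grad u - u grad v]. *)
Let E (e : R) x :=
  form (a x) (fun i => (v x + e) * partial i u x + - u x * partial i v x)
             (fun i => (v x + e) * partial i u x + - u x * partial i v x).

Let bE e : bcont D (E e).
Proof.
have [[[bu Hu] _] _] := dirichlet_phi hD hphi k.
have [[[bv Hv] _] _] := dirichlet_phi hD hphi 0.
have bp i : bcont D (fun x => (v x + e) * partial i u x + - u x * partial i v x).
  apply: bcontD; apply: bcontM.
  - by apply: bcontD => //; exact: bcont_cst.
  - by case: (Hu i).
  - exact: bcontN.
  - by case: (Hv i).
apply: bcont_sum => i _; apply: bcontM => //.
by apply: bcont_sum => j _; apply: bcontM => //; exact: (bcont_a oD bD hab).
Qed.

Let E_ge0 e x : 0 <= E e x. Proof. exact: form_ge0. Qed.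

(** Green's identity for [u] tested with [u], minus Green's identity for [v]
    tested with [u^2 / (v + e)]. Since [v] vanishes on the boundary, [e > 0] is
    needed for the second test function to have bounded derivatives. *)
Lemma picone_defect e : 0 < e ->
  (\int[mu]_(x in D) (E e x * (v x + e)^-1 ^+ 2) =
   - 2 * lam 0 * \int[mu]_(x in D) (u x ^+ 2 * (e * (v x + e)^-1)))%R.
Proof.
move=> e0.
have [u2 cu] := dirichlet_phi hD hphi k; have [u1 _] := u2.
have [v2 cv] := dirichlet_phi hD hphi 0; have [v1 _] := v2.
have [bu Hu] := u1; have [bv Hv] := v1.
have v0 x : D x -> 0 < v x := @phi0_gt0 _ _ _ _ _ _ _ _ hphi x.
have ve x : D x -> e <= v x + e by move=> /v0 vx; rewrite lerDr ltW.
have ve0 x : D x -> v x + e != 0.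
  by move=> /ve h; exact: lt0r_neq0 (lt_le_trans e0 h).
have ve1 := C1bV e0 ve (C1bD v1 (C1b_cst D e)).
have w1 := C1bM (C1bM u1 u1) ve1.
set w := fun x => u x * u x * (v x + e)^-1.
have cw : continuous (w \_ D).
  have -> : w \_ D = (u \_ D) \* (u \_ D) \*
      (fun x => ((v \_ D) x + e)^-1).
    apply/funext => x /=; rewrite !patchE; case: ifPn => // _.
    by rewrite -[LHS]/(0 : R) -[point]/(0 : R) !mul0r.
  move=> x; apply: continuousM; first by apply: continuousM; exact: cu.
  apply: continuousV; last first.
    by apply: continuousD; [exact: cv|exact: cst_continuous].
  rewrite patchE; case: ifPn => [/[!inE]|_]; first exact: ve0.
  by rewrite -[point]/(0 : R) add0r gt_eqF.
have bVe : bcont D (fun x => (v x + e)^-1) by case: ve1.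
have g1 := green_dirichlet hD hab hQ hmu hphi u2 u1 cu.
have g2 := green_dirichlet hD hab hQ hmu hphi v2 w1 cw.
set I1 := (fun x => 2 * (u x * opL a b u x) + _) in g1.
set I2 := (fun x => 2 * (w x * opL a b v x) + _) in g2.
have bI1 : bcont D I1.
  apply: bcontD; last by apply: (bcont_form hD hab u2) => i; case: (Hu i).
  exact: (bcontZ 2 (bcontM bu (bcont_opL oD bD hab u2))).
have bI2 : bcont D I2.
  have [bw Hw] := w1.
  apply: bcontD; last by apply: (bcont_form hD hab v2) => i; case: (Hw i).
  exact: (bcontZ 2 (bcontM bw (bcont_opL oD bD hab v2))).
have bE1 : bcont D (fun x => E e x * (v x + e)^-1 ^+ 2).
  exact: (bcontM (bE e) (bcontX 2 bVe)).
have bE2 : bcont D (fun x => u x ^+ 2 * (e * (v x + e)^-1)).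
  exact: (bcontM (bcontX 2 bu) (bcontZ e bVe)).
have I12 x : D x -> I1 x - I2 x =
    E e x * (v x + e)^-1 ^+ 2 + 2 * lam 0 * (u x ^+ 2 * (e * (v x + e)^-1)).
  move=> Dx; have vx := ve0 x Dx; pose t := u x * (v x + e)^-1.
  have p := picone_identity (grad u x) (grad v x) t (aT x).
  rewrite /I1 /I2 /=.
  set F2 := form _ (fun i => _ + _ * (- _ * _)) _.
  have -> : F2 = form (a x) (fun i => 2 * t * partial i u x +
      - (t ^+ 2) * partial i v x) (grad v x).
    by congr form; apply/funext => i; rewrite /t /u /v addr0; ring.
  rewrite (phi_eigen hphi k Dx) (phi_eigen hphi 0 Dx) hk -/u -/v.
  have -> : E e x * (v x + e)^-1 ^+ 2 = form (a x)
      (fun i => 1 * partial i u x + - t * partial i v x)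
      (fun i => 1 * partial i u x + - t * partial i v x).
    by rewrite /E !form_sqr// /t; field.
  by rewrite -p /w; field.
have : (\int[mu]_(x in D) (I1 x - I2 x) = 0)%R.
  by rewrite (RintegralB_bcont mu oD bI1 bI2) g1 g2 subr0.
have -> : (\int[mu]_(x in D) (I1 x - I2 x) =
    \int[mu]_(x in D) (E e x * (v x + e)^-1 ^+ 2 +
      2 * lam 0 * (u x ^+ 2 * (e * (v x + e)^-1))))%R.
  by apply: eq_Rintegral => x /[!inE] Dx; exact: I12.
rewrite (RintegralD_bcont mu oD bE1 (bcontZ _ bE2)).
rewrite (RintegralZ_bcont mu oD _ bE2) => /eqP; rewrite addr_eq0 => /eqP ->.
by rewrite !mulNr.
Qed.

(** [E e] is [(v + e)^2], which is bounded, times the integrand on the left of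
    [picone_defect]; the right side there tends to 0 with [e], by dominated
    convergence, since [e / (v + e)] does so where [v > 0]. *)
Lemma picone_limit : (\int[mu]_(x in D) E 0 x = 0)%R.
Proof.
have bu := bcont_phi hD hphi k; have bv := bcont_phi hD hphi 0.
have v0 x : D x -> 0 < v x := @phi0_gt0 _ _ _ _ _ _ _ _ hphi x.
pose e N : R := (N.+1%:R)^-1.
have e0 N : 0 < e N by rewrite invr_gt0.
have e1 N : e N <= 1 by rewrite invf_le1// ler1n.
have ce : e @ \oo --> (0 : R) by exact: cvg_harmonic.
have ve N x : D x -> e N <= v x + e N by move=> /v0 vx; rewrite lerDr ltW.
have bVe N : bcont D (fun x => (v x + e N)^-1).
  by apply: (bcontV (e0 N)); [exact: ve|apply: bcontD => //; exact: bcont_cst].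
have ratio N x : D x -> 0 <= e N * (v x + e N)^-1 <= 1.
  move=> Dx; have p : 0 < v x + e N by exact: lt_le_trans (e0 N) (ve N x Dx).
  apply/andP; split; first by rewrite mulr_ge0// ?invr_ge0 ltW.
  by rewrite ler_pdivrMr// mul1r ve.
have [_ [Mv vM]] := bv.
have [u2 _] := dirichlet_phi hD hphi k; have [[_ Hu] _] := u2.
have [v2 _] := dirichlet_phi hD hphi 0; have [[_ Hv] _] := v2.
pose fuu x := form (a x) (grad u x) (grad u x).
pose fuv x := form (a x) (grad u x) (grad v x).
have bfuu : bcont D fuu by apply: (bcont_form hD hab u2) => i; case: (Hu i).
have bfuv : bcont D fuv by apply: (bcont_form hD hab v2) => i; case: (Hu i).
pose B x := 2 * (v x * fuu x - u x * fuv x).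
have bB : bcont D B by exact: (bcontZ 2 (bcontB (bcontM bv bfuu) (bcontM bu bfuv))).
have E_split N x : E (e N) x = E 0 x + (e N * B x + e N ^+ 2 * fuu x).
  by rewrite /E !form_sqr// /B /fuu /fuv; ring.
pose r N x := u x ^+ 2 * (e N * (v x + e N)^-1).
have br N : bcont D (r N) by exact: (bcontM (bcontX 2 bu) (bcontZ _ (bVe N))).
have [_ [Mu uM]] := bcontX 2 bu.
have r_cvg : (fun N => \int[mu]_(x in D) r N x)%R @ \oo --> (0 : R).
  have Rint0 : (\int[mu]_(x in D) (0 : R))%R = 0 :> R.
    by rewrite /Rintegral integral0.
  rewrite -Rint0.
  apply: (@dominated_Rintegral _ _ mu D oD r (fun=> 0) Mu br (bcont_cst D 0)).
    move=> x Dx; have vx := v0 x Dx.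
    have -> : 0 = u x ^+ 2 * (0 * (v x + 0)^-1) :> R by rewrite mul0r mulr0.
    apply: cvgMr; apply: cvgM => //; apply: cvgV; first by rewrite addr0 gt_eqF.
    by apply: cvgD => //; exact: cvg_cst.
  move=> N x Dx; have /andP[p q] := ratio N x Dx.
  rewrite /r normrM (ger0_norm p).
  by apply: le_trans (uM x Dx); rewrite -[leRHS]mulr1 ler_wpM2l.
have A_le N : 0 <= (\int[mu]_(x in D) E (e N) x)%R <=
    (Mv + 1) ^+ 2 * (- 2 * lam 0 * \int[mu]_(x in D) r N x)%R.
  apply/andP; split; first by apply: Rintegral_ge0 => x _; exact: E_ge0.
  rewrite -(picone_defect (e0 N)).
  have bd := bcontM (bE (e N)) (bcontX 2 (bVe N)).
  rewrite -(RintegralZ_bcont mu oD _ bd).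
  apply: (le_Rintegral_bcont mu oD (bE _) (bcontZ _ bd)) => x Dx.
  have p : 0 < v x + e N by exact: lt_le_trans (e0 N) (ve N x Dx).
  rewrite mulrCA -[leLHS]mulr1 ler_wpM2l// -exprMn.
  apply: exprn_ege1; rewrite ler_pdivlMr// mul1r lerD//.
  exact: le_trans (ler_norm _) (vM x Dx).
have A_cvg : (fun N => \int[mu]_(x in D) E (e N) x)%R @ \oo --> (0 : R).
  apply: (@squeeze_cvgr _ _ _ _ (fun=> 0) (fun N => (Mv + 1) ^+ 2 *
    (- 2 * lam 0 * \int[mu]_(x in D) r N x)%R)).
  - exact: nearW.
  - exact: cvg_cst.
  - have h : (fun N => (Mv + 1) ^+ 2 *
        (- 2 * lam 0 * \int[mu]_(x in D) r N x)%R) @ \oo -->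
        (Mv + 1) ^+ 2 * (- 2 * lam 0 * 0).
      by apply: cvgMr; apply: cvgMr.
    by rewrite !mulr0 in h.
(* [E e] is a quadratic polynomial in [e] with constant term [E 0]. *)
have A_split N : (\int[mu]_(x in D) E (e N) x)%R = (\int[mu]_(x in D) E 0 x)%R +
    (e N * \int[mu]_(x in D) B x + e N ^+ 2 * \int[mu]_(x in D) fuu x)%R.
  under eq_Rintegral do rewrite E_split.
  rewrite (RintegralD_bcont mu oD (bE 0) (bcontD (bcontZ _ bB) (bcontZ _ bfuu))).
  rewrite (RintegralD_bcont mu oD (bcontZ _ bB) (bcontZ _ bfuu)).
  by rewrite (RintegralZ_bcont mu oD _ bB) (RintegralZ_bcont mu oD _ bfuu).
have : (fun N => \int[mu]_(x in D) E (e N) x)%R @ \oo -->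
    (\int[mu]_(x in D) E 0 x)%R + (0 * \int[mu]_(x in D) B x +
      (0 * 0) * \int[mu]_(x in D) fuu x)%R.
  under eq_fun do rewrite A_split expr2.
  apply: cvgD; first exact: cvg_cst.
  by apply: cvgD; apply: cvgMl => //; apply: cvgM.
rewrite !mul0r !addr0 => /cvg_unique; apply => //.
Qed.

(** The principal eigenvalue is simple: [E 0] is a nonnegative continuous function
    with zero integral, so that [v grad u = u grad v] and [u / v] has zero
    gradient. *)
Lemma eigenfunction_proportional : exists c, forall x, D x -> u x = c * v x.
Proof.
have [u2 _] := dirichlet_phi hD hphi k; have [[bu Hu] _] := u2.
have [v2 _] := dirichlet_phi hD hphi 0; have [[bv Hv] _] := v2.
have v0 x : D x -> 0 < v x := @phi0_gt0 _ _ _ _ _ _ _ _ hphi x.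
have vn0 x : D x -> v x != 0 by move=> /v0 h; rewrite gt_eqF.
have Z x : D x -> E 0 x = 0.
  move=> Dx; apply/eqP; apply: contrapT => /negP Ex.
  have := @gt0_Rintegral_bcont _ _ mu D oD mu_open _ (bE 0) (fun x _ => E_ge0 0 x).
  by rewrite picone_limit ltxx => /(_ (ex_intro2 _ _ x Dx Ex)).
have [_ conD [x0 Dx0] _] := hD.
exists (u x0 * (v x0)^-1) => x Dx.
have -> : u x0 * (v x0)^-1 = u x * (v x)^-1; last by rewrite divfK// vn0.
pose q y := u y * (v y)^-1.
apply: (@connected_zero_gradient_cst _ _ D q oD conD) => //.
  move=> y Dy; apply: continuousM; first by case: bu => cu _; exact: cu.
  by apply: continuousV; [exact: vn0|case: bv => cv _; exact: cv].
move=> y i Dy; have [du _] := Hu i; have [dv _] := Hv i.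
have [dvy Ev] := dv y Dy.
have dV : is_derive y (e_ i) (fun z => (v z)^-1) (- (v y) ^- 2 *: partial i v y).
  split; first exact: derivableV (vn0 y Dy) dvy.
  by rewrite deriveV// vn0.
have H := is_deriveM (du y Dy) dV.
apply: (@is_derive_eq _ _ _ _ _ _ _ _ H).
have := form_eq0 (apos y) (Z y Dy) i; rewrite addr0 => h.
rewrite /GRing.scale /=.
have -> : u y * (- v y ^- 2 * partial i v y) + (v y)^-1 * partial i u y =
  v y ^- 2 * (v y * partial i u y + - u y * partial i v y) by field; exact: vn0.
by rewrite h mulr0.
Qed.

End Simplicity.

(** * Variation of the resolvent multipliers, and an argument on signs *)

Section Multipliers.
Context (R : realType).
Implicit Types (x y s t : R).

Lemma norm_le_sqr (c w : R) : 0 <= w -> c ^+ 2 <= w ^+ 2 -> `|c| <= w.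
Proof.
move=> w0 h.
by rewrite -(ler_pXn2r (n := 2))//= ?nnegrE// real_normK ?num_real.
Qed.

(** Real and imaginary parts of [1 / (s - z)] at a real point [s], where
    [z = x + i y]. *)
Definition resolvent_re x y s := (s - x) / ((s - x) ^+ 2 + y ^+ 2).
Definition resolvent_im x y s := y / ((s - x) ^+ 2 + y ^+ 2).

Variables (x y C : R).
Hypothesis y0 : y != 0.

Let d s := (s - x) ^+ 2 + y ^+ 2.

Lemma resolvent_den_gt0 s : 0 < (s - x) ^+ 2 + y ^+ 2.
Proof. by rewrite ltr_wpDl ?sqr_ge0// exprn_even_gt0. Qed.

Let d0 s : 0 < d s. Proof. exact: resolvent_den_gt0. Qed.

Let K := 2 * (1 + (C - x) ^+ 2 / y ^+ 2).

Let y2 : 0 < y ^+ 2. Proof. by rewrite exprn_even_gt0. Qed.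

Let K_ge0 : 0 <= K.
Proof. by rewrite mulr_ge0// addr_ge0// divr_ge0 ?sqr_ge0. Qed.

Let d_lower s : (C - s) ^+ 2 <= K * d s.
Proof.
have h : (C - s) ^+ 2 <= 2 * (C - x) ^+ 2 + 2 * (s - x) ^+ 2.
  by have := sqr_ge0 ((C - x) + (s - x)); rewrite !expr2; lra.
apply: (le_trans h); rewrite /K /d.
have -> : 2 * (1 + (C - x) ^+ 2 / y ^+ 2) * ((s - x) ^+ 2 + y ^+ 2) =
  2 * (C - x) ^+ 2 + 2 * (s - x) ^+ 2 +
  (2 * y ^+ 2 + 2 * ((C - x) ^+ 2 / y ^+ 2 * (s - x) ^+ 2)) by field.
have k0 : 0 <= (C - x) ^+ 2 / y ^+ 2 by rewrite divr_ge0 ?sqr_ge0.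
rewrite lerDl; apply: addr_ge0; apply: mulr_ge0 => //; first exact: ltW.
by apply: mulr_ge0 => //; exact: sqr_ge0.
Qed.

(** [1 / (s - z) - 1 / (t - z)] has modulus [|s - t| / (|s - z| |t - z|)], and
    [|s - z|] dominates [C - s] because [z] is not real. *)
Let variation s t : t <= s -> s < C ->
  (resolvent_re x y s - resolvent_re x y t) ^+ 2 +
  (resolvent_im x y s - resolvent_im x y t) ^+ 2 <=
  (K * ((C - s)^-1 - (C - t)^-1)) ^+ 2.
Proof.
move=> ts sC; have ds := d0 s; have dt := d0 t.
have Cs : 0 < C - s by rewrite subr_gt0.
have Ct : 0 < C - t by rewrite subr_gt0 (le_lt_trans ts).
have -> : (resolvent_re x y s - resolvent_re x y t) ^+ 2 +
    (resolvent_im x y s - resolvent_im x y t) ^+ 2 = (s - t) ^+ 2 / (d s * d t).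
  rewrite /resolvent_re /resolvent_im /d; field.
  by rewrite !gt_eqF//; apply: d0.
have -> : (C - s)^-1 - (C - t)^-1 = (s - t) / ((C - s) * (C - t)).
  by field; rewrite !gt_eqF.
rewrite mulrCA exprMn ler_wpM2l ?sqr_ge0// exprMn exprVn.
rewrite -[leLHS]mul1r ler_pdivrMr ?mulr_gt0// mulrAC ler_pdivlMr; last first.
  by rewrite exprn_gt0// mulr_gt0.
rewrite mul1r exprMn.
have -> : K ^+ 2 * (d s * d t) = (K * d s) * (K * d t) by ring.
by apply: ler_pM; rewrite ?sqr_ge0.
Qed.

Let gap_ge0 s t : t <= s -> s < C -> 0 <= K * ((C - s)^-1 - (C - t)^-1).
Proof.
move=> ts sC; apply: mulr_ge0 => //; rewrite subr_ge0 lef_pV2 ?posrE ?subr_gt0//.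
  by rewrite lerD2l lerN2.
exact: le_lt_trans sC.
Qed.

Lemma resolvent_re_variation s t : t <= s -> s < C ->
  `|resolvent_re x y s - resolvent_re x y t| <= K * ((C - s)^-1 - (C - t)^-1).
Proof.
move=> ts sC; apply: norm_le_sqr; first exact: gap_ge0.
by apply: le_trans (variation ts sC); rewrite lerDl sqr_ge0.
Qed.

Lemma resolvent_im_variation s t : t <= s -> s < C ->
  `|resolvent_im x y s - resolvent_im x y t| <= K * ((C - s)^-1 - (C - t)^-1).
Proof.
move=> ts sC; apply: norm_le_sqr; first exact: gap_ge0.
by apply: le_trans (variation ts sC); rewrite lerDr sqr_ge0.
Qed.

Lemma resolvent_bound s :
  `|resolvent_re x y s| <= `|y|^-1 /\ `|resolvent_im x y s| <= `|y|^-1.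
Proof.
have h : resolvent_re x y s ^+ 2 + resolvent_im x y s ^+ 2 <= `|y|^-1 ^+ 2.
  rewrite exprVn real_normK ?num_real//.
  have -> : resolvent_re x y s ^+ 2 + resolvent_im x y s ^+ 2 = (d s)^-1.
    by rewrite /resolvent_re /resolvent_im /d; field; exact: lt0r_neq0 (d0 s).
  by rewrite lef_pV2 ?posrE// lerDr sqr_ge0.
have w0 : 0 <= `|y|^-1 by rewrite invr_ge0.
split; apply: norm_le_sqr => //; apply: le_trans h.
  by rewrite lerDl sqr_ge0.
by rewrite lerDr sqr_ge0.
Qed.

Lemma mul_resolvent_re s :
  s * resolvent_re x y s = 1 + (x * resolvent_re x y s - y * resolvent_im x y s).
Proof. by rewrite /resolvent_re /resolvent_im; field; exact: lt0r_neq0 (d0 s). Qed.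

Lemma mul_resolvent_im s :
  s * resolvent_im x y s = y * resolvent_re x y s + x * resolvent_im x y s.
Proof. by rewrite /resolvent_re /resolvent_im; field; exact: lt0r_neq0 (d0 s). Qed.

(** The two multipliers are the real and imaginary parts of [s / (s - z)]. Along a
    nonincreasing sequence their variation is dominated by the decrease of
    [1 / (C - s)]: this is what summation by parts needs. *)
Lemma multiplier_variation s t : t <= s -> s < C ->
  let M := (`|x| + `|y|) * K in
  `|s * resolvent_re x y s - t * resolvent_re x y t| <=
     M * (C - s)^-1 - M * (C - t)^-1 /\
  `|s * resolvent_im x y s - t * resolvent_im x y t| <=
     M * (C - s)^-1 - M * (C - t)^-1.
Proof.
move=> ts sC M; rewrite !mul_resolvent_re !mul_resolvent_im -mulrBr /M -mulrA.
have h1 := resolvent_re_variation ts sC; have h2 := resolvent_im_variation ts sC.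
have -> : 1 + (x * resolvent_re x y s - y * resolvent_im x y s) -
    (1 + (x * resolvent_re x y t - y * resolvent_im x y t)) =
    x * (resolvent_re x y s - resolvent_re x y t) +
    - y * (resolvent_im x y s - resolvent_im x y t) by ring.
have -> : y * resolvent_re x y s + x * resolvent_im x y s -
    (y * resolvent_re x y t + x * resolvent_im x y t) =
    x * (resolvent_im x y s - resolvent_im x y t) +
    y * (resolvent_re x y s - resolvent_re x y t) by ring.
rewrite mulrDl; split; apply: (le_trans (ler_normD _ _)); rewrite !normrM ?normrN;
  by apply: lerD; rewrite ler_wpM2l.
Qed.

Lemma multiplier_bound s :
  let B := 1 + (`|x| + `|y|) * `|y|^-1 in
  `|s * resolvent_re x y s| <= B /\ `|s * resolvent_im x y s| <= B.
Proof.
move=> B; have [h1 h2] := resolvent_bound s.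
rewrite mul_resolvent_re mul_resolvent_im /B mulrDl; split.
  apply: (le_trans (ler_normD _ _)); rewrite normr1 lerD2l.
  apply: (le_trans (ler_normB _ _)); rewrite (normrM x) (normrM y).
  by apply: lerD; rewrite ler_wpM2l.
apply: (le_trans (ler_normD _ _)); rewrite (normrM y) (normrM x).
apply: (@le_trans _ _ (`|y| * `|y|^-1 + `|x| * `|y|^-1)).
  by apply: lerD; rewrite ler_wpM2l.
by rewrite addrC lerDr.
Qed.

End Multipliers.

Section Signs.
Context (R : realType).

Lemma series_ge0_lim0 (s : nat -> R) : (forall k, 0 <= s k) ->
  (fun N => \sum_(0 <= k < N) s k) @ \oo --> (0 : R) -> forall k, s k = 0.
Proof.
move=> s0 cs k; apply/le_anti; rewrite s0 andbT.
have <- : limn (fun N => \sum_(0 <= k < N) s k) = 0 by exact: cvg_lim.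
apply: limr_ge; first by apply/cvg_ex; exists 0.
exists k.+1 => // N /= kN.
rewrite (big_cat_nat (n := k.+1))//= big_nat_recr//= addrAC.
by rewrite lerDr addr_ge0// sumr_ge0.
Qed.

(** The real and imaginary parts of [sum t k / (lam k - z) = 0] combine into
    [sum t k / |lam k - z|^2 = 0] and
    [sum t k (lam 0 - lam k) / |lam k - z|^2 = 0]. In the second sum the term
    [k = 0] disappears, so that the remaining terms, being of one sign, all
    vanish; then the first sum reduces to its positive term [k = 0]. *)
Lemma one_sign_contradiction (x y : R) (lam t : nat -> R) : y != 0 ->
  (forall k, (1 <= k)%N -> lam k < lam 0%N) -> 0 < t 0%N ->
  ((forall k, (1 <= k)%N -> 0 <= t k) \/ (forall k, (1 <= k)%N -> t k <= 0)) ->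
  (fun N => \sum_(0 <= k < N) t k * resolvent_re x y (lam k)) @ \oo --> (0 : R) ->
  (fun N => \sum_(0 <= k < N) t k * resolvent_im x y (lam k)) @ \oo --> (0 : R) ->
  False.
Proof.
move=> y0 ltlam t0 sgn cre cim.
pose w k := ((lam k - x) ^+ 2 + y ^+ 2)^-1.
have w0 k : 0 < w k by rewrite invr_gt0 resolvent_den_gt0.
have csum : (fun N => \sum_(0 <= k < N) t k * w k) @ \oo --> (0 : R).
  have h : (fun N => y^-1 * \sum_(0 <= k < N) t k * resolvent_im x y (lam k)) @ \oo
      --> y^-1 * (0 : R) by exact: cvgMr.
  rewrite mulr0 in h; apply: cvg_trans h; apply: near_eq_cvg; apply: nearW => N.
  rewrite mulr_sumr; apply: eq_bigr => k _.
  by rewrite /resolvent_im -/(w k); field.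
have cdiff : (fun N => \sum_(0 <= k < N) t k * w k * (lam 0%N - lam k)) @ \oo
    --> (0 : R).
  have h : (fun N => (lam 0%N - x) * (\sum_(0 <= k < N) t k * w k) -
      \sum_(0 <= k < N) t k * resolvent_re x y (lam k)) @ \oo
      --> (lam 0%N - x) * 0 - (0 : R) by apply: cvgB => //; exact: cvgMr.
  rewrite mulr0 subr0 in h.
  apply: cvg_trans h; apply: near_eq_cvg; apply: nearW => N.
  rewrite mulr_sumr -sumrB; apply: eq_bigr => k _.
  by rewrite /resolvent_re -/(w k); ring.
case: sgn => sgn.
  have h k : 0 <= t k * w k.
    by case: k => [|k]; rewrite mulr_ge0// ?(ltW (w0 _))// ?(ltW t0)// sgn.
  by have := series_ge0_lim0 h csum 0%N; apply/eqP; rewrite mulf_neq0// gt_eqF.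
have h k : 0 <= - (t k * w k * (lam 0%N - lam k)).
  case: k => [|k]; first by rewrite subrr mulr0 oppr0.
  rewrite oppr_ge0 mulr_le0_ge0// ?subr_ge0 ?(ltW (ltlam _ _))//.
  by rewrite mulr_le0_ge0// ?sgn// ltW.
have cdiffN : (fun N => \sum_(0 <= k < N) - (t k * w k * (lam 0%N - lam k))) @ \oo
    --> (0 : R).
  have h' := cvgN cdiff; rewrite oppr0 in h'.
  by under eq_fun do rewrite sumrN; exact: h'.
have tz k : (1 <= k)%N -> t k = 0.
  move=> k1; have /eqP := series_ge0_lim0 h cdiffN k.
  rewrite oppr_eq0 !mulf_eq0 subr_eq0 (gt_eqF (w0 k)) (gt_eqF (ltlam k k1)) !orbF.
  by move/eqP.
have h' k : 0 <= t k * w k.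
  case: k => [|k]; first by rewrite ltW// mulr_gt0.
  by rewrite tz// mul0r.
by have := series_ge0_lim0 h' csum 0%N; apply/eqP; rewrite mulf_neq0// gt_eqF.
Qed.

End Signs.

(** * Integrating Fourier series against the jump measure *)

Section Expansion.
Context (R : realType) (n : nat).
Local Notation V := 'rV[R]_n.+1.
Variables (D : set V) (a : V -> 'M[R]_n.+1) (b : V -> V) (Q : V -> R) (alpha : R)
  (mu : probability (euc R n.+1) R) (lam : nat -> R) (phi : nat -> V -> R).
Hypotheses (hD : bounded_domain D)
  (hab : elliptic_coefficients alpha a b)
  (hQ : drift_potential D a b Q) (hmu : reversible_measure D Q mu)
  (hphi : dirichlet_eigenbasis a b D mu lam phi).
Implicit Types f g w u : V -> R.

Let oD : open D. Proof. by case: hD. Qed.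
Let mD : measurable (D : set (euc R n.+1)).
Proof. exact: open_measurable_euc. Qed.
Let mu_open U : open U -> U `<=` D -> U !=set0 ->
  (0 < mu (U : set (euc R n.+1)))%E.
Proof. exact: (mu_open_gt0 oD hQ hmu). Qed.

(** This is where self-adjointness enters. *)
Lemma coef_opL u k : dirichlet_C2 D u ->
  inner D mu (opL a b u) (phi k) = lam k * inner D mu u (phi k).
Proof.
move=> hu; have hp := dirichlet_phi hD hphi k.
have bu : bcont D u by case: hu => -[[]].
rewrite /inner -(RintegralZ_bcont mu oD _ (bcontM bu (bcont_phi hD hphi k))).
transitivity (\int[mu]_(x in D) (phi k x * opL a b u x))%R.
  by apply: eq_Rintegral => x _; rewrite mulrC.
rewrite (opL_symmetric hD hab hQ hmu hphi hu hp).
apply: eq_Rintegral => x /[!inE] Dx.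
by rewrite (phi_eigen hphi k Dx) mulrCA.
Qed.

Lemma bcont_square_integrable f : bcont D f -> square_integrable D mu f.
Proof.
move=> bf; split; first by case: bf => cf _; exact: continuous_measurable_euc.
by rewrite (integral_EFin_bcont mu oD (bcontX 2 bf)) ltry.
Qed.

Definition fourier_sum f N x := \sum_(0 <= k < N) inner D mu f (phi k) * phi k x.

Lemma bcont_fourier_sum f N : bcont D (fourier_sum f N).
Proof.
by apply: bcont_sum => k _; apply: bcontZ; exact: (bcont_phi hD hphi).
Qed.

Lemma fourier_sum_cvg f : bcont D f ->
  (fun N => \int[mu]_(x in D) ((f x - fourier_sum f N x) ^+ 2))%R @ \oo -->
  (0 : R).
Proof.
move=> bf; have [_ _ _ + _] := hphi => /(_ f (bcont_square_integrable bf)).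
by move=> /fine_cvgP[].
Qed.

(** If [f] differed from the [M]-th sum by more than [e] at some point of [D], all
    later sums would stay away from [f] on a neighbourhood of it, against
    convergence in mean square. *)
Lemma fourier_sum_uniform_bound f M (e : R) : bcont D f -> 0 <= e ->
  (forall N x, (M <= N)%N -> D x ->
     `|fourier_sum f N x - fourier_sum f M x| <= e) ->
  forall x, D x -> `|f x - fourier_sum f M x| <= e.
Proof.
move=> bf e0 cauchy x Dx; rewrite leNgt; apply/negP => lt.
pose h x := `|f x - fourier_sum f M x| - e.
have bh : bcont D h.
  apply: bcontB; last exact: bcont_cst.
  by apply: bcont_norm; apply: bcontB => //; exact: bcont_fourier_sum.
pose psi x := Num.max (h x) 0 ^+ 2.
have bpsi : bcont D psi by apply: bcontX; exact: bcont_pos.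
have psi0 y : D y -> 0 <= psi y by move=> _; exact: sqr_ge0.
have : (0 < \int[mu]_(x in D) psi x)%R.
  apply: (gt0_Rintegral_bcont oD mu_open bpsi psi0); exists x => //.
  have hx : 0 < h x by rewrite subr_gt0.
  by rewrite /psi max_l ?ltW// expf_neq0// gt_eqF.
apply/negP; rewrite -leNgt.
have <- := cvg_lim (@Rhausdorff R) (fourier_sum_cvg bf).
apply: limr_ge; first by apply/cvg_ex; exists 0; exact: fourier_sum_cvg.
exists M => // N /= MN.
have bd := bcontB bf (bcont_fourier_sum f N).
apply: (le_Rintegral_bcont mu oD bpsi (bcontX 2 bd)) => y Dy.
have hle : h y <= `|f y - fourier_sum f N y|.
  rewrite /h lerBlDr; apply: (le_trans _ (lerD (lexx _) (cauchy N y MN Dy))).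
  by apply: le_trans (ler_normD _ _); rewrite addrA subrK.
rewrite /psi -[leRHS]real_normK ?num_real//.
by rewrite lerXn2r ?nnegrE ?le_max ?lexx ?orbT// ge_max hle normr_ge0.
Qed.

Lemma zero_coefs_eq0 f : bcont D f ->
  (forall k, inner D mu f (phi k) = 0) -> forall x, D x -> f x = 0.
Proof.
move=> bf f0 x Dx.
have Z N y : fourier_sum f N y = 0.
  by rewrite /fourier_sum big1// => k _; rewrite f0 mul0r.
have := @fourier_sum_uniform_bound f 0 0 bf (lexx 0) _ x Dx.
rewrite !Z subr0 normr_le0 => h; apply/eqP; apply: h => N y _ _.
by rewrite !Z subrr normr0.
Qed.

Variable nu : probability (euc R n.+1) R.
Hypothesis hnu : nu D = 1%E.

Local Notation F k := (\int[mu]_(x in D) phi k x)%R.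
Local Notation G k := (\int[nu]_(x in D) phi k x)%R.

Lemma Rintegral_fourier_sum f N :
  (\int[nu]_(x in D) fourier_sum f N x =
   \sum_(0 <= k < N) inner D mu f (phi k) * \int[nu]_(x in D) phi k x)%R.
Proof.
have bp k := bcont_phi hD hphi k.
rewrite (Rintegral_sum_bcont nu oD N (fun k => bcontZ (inner D mu f (phi k)) (bp k))).
by apply: eq_bigr => k _; rewrite (RintegralZ_bcont nu oD _ (bp k)).
Qed.

(** With a square integrable density the integral against [nu] is an inner
    product, so that it passes to mean square limits. *)
Lemma fourier_nu_density f : bcont D f -> L2_density D mu nu ->
  (fun N => \sum_(0 <= k < N) inner D mu f (phi k) * G k) @ \oo -->
  (\int[nu]_(x in D) f x)%R.
Proof.
move=> bf [h [[mh h2] h0 nuE]].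
have dens g : bcont D g -> mu.-integrable D (EFin \o (fun x => g x * h x)) /\
    (\int[nu]_(x in D) g x = \int[mu]_(x in D) (g x * h x))%R.
  move=> bg.
  have [i E] := integral_density mD mh h0 nuE (bcont_fin_integrable nu oD bg).
  by split => //; rewrite /Rintegral E.
have ih2 : mu.-integrable D (EFin \o (fun x => h x ^+ 2)).
  apply/integrableP; split; first by apply/measurable_EFinP; exact: measurable_funX.
  apply: le_lt_trans h2; apply: ge0_le_integral => //=.
  - by apply/measurable_EFinP; apply: measurableT_comp => //; exact: measurable_funX.
  - by apply/measurable_EFinP; exact: measurable_funX.
  - by move=> x _; rewrite lee_fin ger0_norm// sqr_ge0.
pose H := (\int[mu]_(x in D) (h x ^+ 2))%R.
have H0 : 0 <= H by apply: Rintegral_ge0 => x _; exact: sqr_ge0.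
pose d N := (\int[mu]_(x in D) ((f x - fourier_sum f N x) ^+ 2))%R.
(* Young inequality with a parameter, in place of Cauchy-Schwarz *)
have key N t : 0 < t ->
    `|\int[nu]_(x in D) f x - \int[nu]_(x in D) fourier_sum f N x|%R <=
    t * d N + t^-1 * H.
  move=> t0; have bg := bcontB bf (bcont_fourier_sum f N).
  rewrite -(RintegralB_bcont nu oD bf (bcont_fourier_sum f N)).
  have [ig ->] := dens _ bg.
  apply: (le_trans (le_normr_Rintegral mD ig)).
  have ig2 := bcont_fin_integrable mu oD (bcontZ t (bcontX 2 bg)).
  rewrite /d -(RintegralZ_bcont mu oD _ (bcontX 2 bg)) -(RintegralZl _ mD ih2).
  have ih2' : mu.-integrable D (EFin \o (fun x => t^-1 * h x ^+ 2)).
    exact: (integrableZl mD t^-1 ih2).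
  rewrite -(RintegralD mD ig2 ih2').
  apply: le_Rintegral => //; first by have := integrable_norm ig.
    exact: (integrableD mD ig2 ih2').
  move=> x _; rewrite normrM.
  set p := f x - _; rewrite -[p ^+ 2]real_normK ?num_real//.
  rewrite -[h x ^+ 2]real_normK ?num_real//.
  move: `|p| `|h x| => {}p q.
  have -> : t * p ^+ 2 + t^-1 * q ^+ 2 =
    p * q + t^-1 * ((t * p - q / 2) ^+ 2 + 3 / 4 * q ^+ 2) by field; rewrite gt_eqF.
  rewrite lerDl; apply: mulr_ge0; first by rewrite invr_ge0 ltW.
  apply: addr_ge0; first exact: sqr_ge0.
  by apply: mulr_ge0; [rewrite divr_ge0|exact: sqr_ge0].
have cd : d @ \oo --> (0 : R) by exact: fourier_sum_cvg.
under eq_fun do rewrite -Rintegral_fourier_sum.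
apply/cvgrPdist_lt => e e0.
pose t := 2 * (H + 1) / e.
have t0 : 0 < t by rewrite divr_gt0// mulr_gt0// ltr_wpDl.
have et : 0 < e / (2 * t) by rewrite divr_gt0// mulr_gt0.
move/cvgrPdist_lt : cd => /(_ _ et); apply: filterS => N.
rewrite sub0r normrN => dN.
apply: (le_lt_trans (key N t t0)).
have h1 : t * d N < e / 2.
  have -> : e / 2 = t * (e / (2 * t)) by field; rewrite gt_eqF.
  by rewrite ltr_pM2l//; exact: le_lt_trans (ler_norm _) dN.
have h2' : t^-1 * H <= e / 2.
  rewrite mulrC ler_pdivrMr//.
  have -> : e / 2 * t = H + 1 by rewrite /t; field; rewrite gt_eqF.
  by rewrite lerDl.
by rewrite [ltRHS](splitr e) ltr_leD.
Qed.

(** Summation by parts: multiplying the terms of a uniformly convergent series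
    by a sequence of bounded variation preserves uniform convergence, here to
    [f] by [fourier_sum_uniform_bound]; and uniform limits can be integrated. *)
Lemma fourier_nu_uniform f m r B :
  bcont D f ->
  (exists S : V -> R,
    {uniform D, (fun N x => \sum_(0 <= k < N) F k / lam k * phi k x) @ \oo --> S}) ->
  (forall k, inner D mu f (phi k) = m k * (F k / lam k)) ->
  (forall k, `|m k| <= B) -> (forall k, 0 <= r k) ->
  (forall k, `|m k - m k.+1| <= r k - r k.+1) ->
  (fun N => \sum_(0 <= k < N) inner D mu f (phi k) * G k) @ \oo -->
  (\int[nu]_(x in D) f x)%R.
Proof.
move=> bf [S uS] fm mB r0 mr.
pose s N x := \sum_(0 <= k < N) F k / lam k * phi k x.
have us (e : R) : 0 < e -> exists N0, forall N, (N0 <= N)%N ->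
    forall x, D x -> `|s N x - S x| <= e.
  move=> e0.
  have hN : nbhs (S : {uniform` D -> R})
      [set h : V -> R | forall y, D y -> `|S y - h y| < e].
    apply/uniform_nbhs; exists [set xy | ball xy.1 e xy.2]; split => //.
    by rewrite -entourage_ballE; exists e.
  have [N0 _ hN0] := uS _ hN.
  exists N0 => N N0N x Dx; rewrite distrC.
  exact/ltW/(hN0 N N0N).
have B0 : 0 <= B by exact: le_trans (normr_ge0 _) (mB 0%N).
have r_ni : {homo r : i j / (i <= j)%N >-> j <= i}.
  apply/nonincreasing_seqP => k.
  by have := le_trans (normr_ge0 _) (mr k); rewrite subr_ge0.
pose C := r 0%N + 2 * B.
have C0 : 0 <= C by rewrite addr_ge0// mulr_ge0.
have cauchy (e : R) M : 0 <= e ->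
    (forall N, (M <= N)%N -> forall x, D x -> `|s N x - S x| <= e) ->
    forall N x, (M <= N)%N -> D x ->
      `|fourier_sum f N x - fourier_sum f M x| <= C * e.
  move=> e0 sS N x MN Dx.
  pose sg k := s k x - S x.
  have sge k : (M <= k)%N -> `|sg k| <= e by move=> Mk; exact: sS.
  have step : `|fourier_sum f N x - fourier_sum f M x - m N * sg N + m M * sg M|
      <= e * (r M - r N).
    elim: N MN => [|N IH].
      by rewrite leqn0 => /eqP ->; rewrite !subrr sub0r addNr mulr0 normr0.
    rewrite leq_eqVlt => /orP[/eqP <-|].
      by rewrite !subrr sub0r addNr mulr0 normr0.
    rewrite ltnS => MN; move: (IH MN).
    have fS : fourier_sum f N.+1 x = fourier_sum f N x + m N * (sg N.+1 - sg N).
      rewrite /fourier_sum big_nat_recr//=; congr (_ + _).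
      by rewrite fm /sg /s big_nat_recr//=; ring.
    set X := fourier_sum f N x - fourier_sum f M x - m N * sg N + m M * sg M.
    have -> : fourier_sum f N.+1 x - fourier_sum f M x - m N.+1 * sg N.+1 +
      m M * sg M = X + (m N - m N.+1) * sg N.+1 by rewrite fS /X; ring.
    move=> hX; apply: (le_trans (ler_normD _ _)); rewrite normrM.
    have h : `|m N - m N.+1| * `|sg N.+1| <= (r N - r N.+1) * e.
      by apply: ler_pM => //; apply: sge; exact: leqW.
    by apply: (le_trans (lerD hX h)); lra.
  have -> : fourier_sum f N x - fourier_sum f M x =
      (fourier_sum f N x - fourier_sum f M x - m N * sg N + m M * sg M) +
      (m N * sg N - m M * sg M) by ring.
  apply: (le_trans (ler_normD _ _)).
  have h1 : `|m N * sg N - m M * sg M| <= B * e + B * e.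
    apply: (le_trans (ler_normB _ _)); rewrite !normrM.
    by apply: lerD; apply: ler_pM => //; exact: sge.
  apply: (le_trans (lerD step h1)).
  have h2 : e * (r M - r N) <= e * r 0%N.
    rewrite ler_wpM2l// lerBlDr (le_trans (r_ni _ _ (leq0n M)))// lerDl.
    exact: r0.
  by rewrite /C; move: h2; lra.
under eq_fun do rewrite -Rintegral_fourier_sum.
apply/cvgrPdist_le => e e0.
have e'0 : 0 < e / (C + 1) by rewrite divr_gt0// ltr_wpDl.
have [N0 hN0] := us _ e'0.
exists N0 => // M /= M0.
have Ce : C * (e / (C + 1)) <= e.
  rewrite mulrCA; apply: ler_piMr; first exact: ltW.
  by rewrite ler_pdivrMr ?ltr_wpDl// mul1r lerDl.
have hM := cauchy _ M (ltW e'0) (fun N MN => hN0 N (leq_trans M0 MN)).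
have bnd := fourier_sum_uniform_bound bf (mulr_ge0 C0 (ltW e'0)) hM.
rewrite -(RintegralB_bcont nu oD bf (bcont_fourier_sum f M)).
have bg := bcontB bf (bcont_fourier_sum f M).
apply: (le_trans (ler_norm_Rintegral_bcont nu oD bg (bcont_cst D e) _)).
  by move=> x Dx; exact: le_trans (bnd x Dx) Ce.
have nu1 : fine (nu (D : set (euc R n.+1))) = 1 by rewrite [X in fine X]hnu.
by rewrite (Rintegral_bcont_cst nu oD) [X in _ * X]nu1 mulr1.
Qed.

End Expansion.

(** * Reduction to Dirichlet data *)

Section Shift.
Context (R : realType) (n : nat).
Local Notation V := 'rV[R]_n.
Implicit Types (D : set V) (p : V -> R).

Lemma partial_shift (i : 'I_n) p c : partial i (fun y => p y - c) = partial i p.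
Proof.
apply/funext => x; rewrite /partial /derive.
have -> // : (fun h : R => h^-1 *: (((fun y => p y - c) \o shift x)
    (h *: delta_mx 0 i) - (p x - c))) =
  (fun h : R => h^-1 *: ((p \o shift x) (h *: delta_mx 0 i) - p x)).
by apply/funext => h /=; congr (_ *: _); ring.
Qed.

Lemma opL_shift (a : V -> 'M[R]_n) (b : V -> V) p c x :
  opL a b (fun y => p y - c) x = opL a b p x.
Proof.
have fE i : flux a (fun y => p y - c) i = flux a p i.
  by apply/funext => y; apply: eq_bigr => j _; rewrite partial_shift.
have pE i : partial i (fun y => p y - c) x = partial i p x.
  by rewrite partial_shift.
have e1 : \sum_i partial i (flux a (fun y => p y - c) i) x =
    \sum_i partial i (flux a p i) x.
  by apply: eq_bigr => i _; exact: (congr1 (fun g => partial i g x) (fE i)).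
have e2 : \sum_i b x 0 i * partial i (fun y => p y - c) x =
    \sum_i b x 0 i * partial i p x.
  by apply: eq_bigr => i _; exact: (congr1 (fun t => b x 0 i * t) (pE i)).
exact: (f_equal2 (fun s t => 2^-1 * s + t) e1 e2).
Qed.

End Shift.

Lemma dirichlet_C2_shift (R : realType) (n : nat) (D : set 'rV[R]_n.+1)
    (p : 'rV[R]_n.+1 -> R) c : open D -> bounded_set D ->
  C_closure 2 D p -> (forall x, boundary D x -> p x = c) ->
  dirichlet_C2 D (fun y => p y - c).
Proof.
move=> oD bD Cp pc; have [p1 p2] := C_closure_C2b oD bD Cp; split.
  split; first exact: (C1b_partial oD (C1bD p1 (C1b_cst D (- c)))).
  by move=> j; rewrite partial_shift; exact: p2.
have [cp _] := Cp.
apply: restrict_continuous => //; last first.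
  by move=> x /pc ->; rewrite subrr.
by move=> x; apply: continuousB; [exact: cp|exact: cst_continuous].
Qed.

Section JumpEigenvalue.
Context (R : realType) (n : nat).
Local Notation V := 'rV[R]_n.+1.
Variables (D : set V) (a : V -> 'M[R]_n.+1) (b : V -> V) (Q : V -> R) (alpha : R)
  (mu nu : probability (euc R n.+1) R) (lam : nat -> R) (phi : nat -> V -> R).
Hypotheses (hD : bounded_domain D)
  (hab : elliptic_coefficients alpha a b)
  (hQ : drift_potential D a b Q) (hmu : reversible_measure D Q mu)
  (hphi : dirichlet_eigenbasis a b D mu lam phi)
  (hnu : nu D = 1%E).

Let oD : open D. Proof. by case: hD. Qed.
Let bD : bounded_set D. Proof. by case: hD. Qed.

(** A multiple of [phi 0] is not both orthogonal to [phi 0] and of norm 1. *)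
Lemma lam_lt_lam0 k : (1 <= k)%N -> lam k < lam 0%N.
Proof.
move=> k1; have [_ ndl orth _ _] := hphi.
rewrite lt_neqAle ndl// andbT; apply/eqP => lk.
have [c uc] := eigenfunction_proportional hD hab hQ hmu hphi lk.
have b0 := bcont_phi hD hphi 0%N.
have o0 := orth k 0%N; rewrite gtn_eqF// in o0.
have := orth k k; rewrite eqxx.
have -> : inner D mu (phi k) (phi k) =
    c * inner D mu (phi k) (phi 0%N).
  rewrite /inner -(RintegralZ_bcont mu oD _ (bcontM (bcont_phi hD hphi k) b0)).
  by apply: eq_Rintegral => x /[!inE] Dx; rewrite [X in _ * X]uc//; ring.
by rewrite o0 mulr0 => /eqP; rewrite eq_sym oner_eq0.
Qed.

Lemma gt0_Rintegral_phi0 (m : probability (euc R n.+1) R) : m D = 1%E ->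
  0 < (\int[m]_(x in D) phi 0%N x)%R.
Proof.
move=> mD1; have b0 := bcont_phi hD hphi 0%N.
have p0 x : D x -> 0 < phi 0%N x := @phi0_gt0 _ _ _ _ _ _ _ _ hphi x.
have mD := open_measurable_euc oD.
have mp : measurable_fun (D : set (euc R n.+1)) (fun x => (phi 0%N x)%:E).
  by case: b0 => c0 _; apply/measurable_EFinP; exact: continuous_measurable_euc.
rewrite -lte_fin -(integral_EFin_bcont m oD b0) lt0e integral_ge0 ?andbT; last first.
  by move=> x Dx; rewrite lee_fin ltW// p0.
apply/eqP => I0.
have : ae_eq m (D : set (euc R n.+1)) (fun x => (phi 0%N x)%:E) (cst 0%E).
  apply/(ae_eq_integral_abs _ mD) => //.
  rewrite -[RHS]I0; apply: eq_integral => x /[!inE] Dx.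
  by rewrite gee0_abs// lee_fin ltW// p0.
move=> [N [mN N0 DN]].
have : (m D <= m N)%E.
  apply: le_measure; rewrite ?inE// => x Dx; apply: DN => /= /(_ Dx)[].
  by apply/eqP; rewrite gt_eqF// p0.
by rewrite mD1 N0 leNgt lte01.
Qed.

Local Notation F k := (\int[mu]_(x in D) phi k x)%R.
Local Notation G k := (\int[nu]_(x in D) phi k x)%R.

(** [F k / (lam k - z)] is the product of [F k / lam k], the coefficient of the
    series assumed to converge uniformly, and of [lam k / (lam k - z)], which
    has bounded variation in [k]. *)
Lemma resolvent_series_cvg x y f : y != 0 -> bcont D f ->
  L2_density D mu nu \/ (exists S : V -> R,
    {uniform D, (fun N x => \sum_(0 <= k < N) F k / lam k * phi k x) @ \oo --> S}) ->
  (exists e, 0 <= e /\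
   ((forall k, inner D mu f (phi k) = e * (F k * resolvent_re x y (lam k))) \/
    (forall k, inner D mu f (phi k) = e * (F k * resolvent_im x y (lam k))))) ->
  (fun N => \sum_(0 <= k < N) inner D mu f (phi k) * G k) @ \oo -->
  (\int[nu]_(x in D) f x)%R.
Proof.
move=> y0 bf [dens _|unif]; first exact: (fourier_nu_density hD hphi bf dens).
move=> [e [e0 fe]].
have [_ ndl _ _ _] := hphi.
pose C := lam 0%N + 1.
have lamC k : lam k < C by rewrite (le_lt_trans (ndl 0%N k _))// ltrDl.
have lam0 k : lam k != 0 by rewrite lt_eqF// (lam_lt0 hD hab hQ hmu hphi).
pose M := (`|x| + `|y|) * (2 * (1 + (C - x) ^+ 2 / y ^+ 2)).
have M0 : 0 <= M.
  rewrite mulr_ge0 ?addr_ge0// mulr_ge0// addr_ge0// divr_ge0// sqr_ge0//.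
pose r k := e * (M * (C - lam k)^-1).
have r0 k : 0 <= r k.
  apply: mulr_ge0 => //; apply: mulr_ge0 => //.
  by rewrite invr_ge0 subr_ge0 ltW.
pose B := e * (1 + (`|x| + `|y|) * `|y|^-1).
case: fe => fe.
  apply: (fourier_nu_uniform hD hQ hmu hphi hnu bf unif (r := r) (B := B)
    (m := fun k => e * (lam k * resolvent_re x y (lam k)))) => //.
  - by move=> k; rewrite fe; field.
  - move=> k; rewrite normrM (ger0_norm e0) ler_wpM2l//.
    by have [] := multiplier_bound x y0 (lam k).
  - move=> k; rewrite -mulrBr /r -mulrBr normrM (ger0_norm e0) ler_wpM2l//.
    by have [] := multiplier_variation x y0 (ndl k k.+1 (leqnSn k)) (lamC k).
apply: (fourier_nu_uniform hD hQ hmu hphi hnu bf unif (r := r) (B := B)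
  (m := fun k => e * (lam k * resolvent_im x y (lam k)))) => //.
- by move=> k; rewrite fe; field.
- move=> k; rewrite normrM (ger0_norm e0) ler_wpM2l//.
  by have [] := multiplier_bound x y0 (lam k).
- move=> k; rewrite -mulrBr /r -mulrBr normrM (ger0_norm e0) ler_wpM2l//.
  by have [] := multiplier_variation x y0 (ndl k k.+1 (leqnSn k)) (lamC k).
Qed.

End JumpEigenvalue.

Section Eigenfunction.
Context (R : realType) (n : nat).
Local Notation V := 'rV[R]_n.+1.
Variables (D : set V) (a : V -> 'M[R]_n.+1) (b : V -> V)
  (nu : probability (euc R n.+1) R) (x y : R) (f : V -> R[i]).
Let p v := complex.Re (f v).
Let q v := complex.Im (f v).

Lemma eigen_Re_Im : (forall v, D v -> opLC a b f v = ((x +i* y)%C * f v)%C) ->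
  forall v, D v -> opL a b p v = x * p v - y * q v /\
                   opL a b q v = x * q v + y * p v.
Proof.
move=> fE v Dv; have := fE v Dv; rewrite /opLC -/p -/q.
have -> : f v = (p v +i* q v)%C by rewrite /p /q; case: (f v).
by case=> -> ->; split => //; rewrite mulrC.
Qed.

Lemma boundary_Re_Im : (forall v, boundary D v -> f v = meanC D nu f) ->
  forall v, boundary D v -> p v = (\int[nu]_(u in D) p u)%R /\
                            q v = (\int[nu]_(u in D) q u)%R.
Proof. by move=> fB v /fB fv; rewrite /p /q fv. Qed.

End Eigenfunction.

(** * Reality of the eigenvalues *)

Lemma inner_combination (R : realType) (n : nat) (D : set 'rV[R]_n)
    (mu : probability (euc R n) R) (g h ph : 'rV[R]_n -> R) (c d e : R) :
  open D -> bcont D g -> bcont D h -> bcont D ph ->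
  inner D mu (fun v => c * g v + d * h v + e) ph =
  c * inner D mu g ph + d * inner D mu h ph + e * (\int[mu]_(v in D) ph v)%R.
Proof.
move=> oD bg bh bp; rewrite /inner.
have b1 := bcontM bg bp; have b2 := bcontM bh bp.
transitivity (\int[mu]_(v in D)
    (c * (g v * ph v) + d * (h v * ph v) + e * ph v))%R.
  by apply: eq_Rintegral => v _; ring.
rewrite (RintegralD_bcont mu oD (bcontD (bcontZ _ b1) (bcontZ _ b2)) (bcontZ _ bp)).
rewrite (RintegralD_bcont mu oD (bcontZ _ b1) (bcontZ _ b2)).
rewrite (RintegralZ_bcont mu oD _ b1) (RintegralZ_bcont mu oD _ b2).
by rewrite (RintegralZ_bcont mu oD _ bp).
Qed.

(** Besides [k = 0] only one index can contribute, and a single number has a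
    sign. *)
Lemma two_terms_one_sign (R : realType) (t : nat -> R) : t 0%N != 0 ->
  ((forall k, (1 <= k)%N -> 0 <= t k) \/ (forall k, (1 <= k)%N -> t k <= 0)) \/
  (exists k1 k2 : nat, forall k, t k != 0 -> k = k1 \/ k = k2) ->
  (forall k, (1 <= k)%N -> 0 <= t k) \/ (forall k, (1 <= k)%N -> t k <= 0).
Proof.
move=> t0 [//|[k1 [k2 h]]].
have [k' hk'] : exists k', forall k, (1 <= k)%N -> t k != 0 -> k = k'.
  have [e|e] := h 0%N t0; [exists k2|exists k1] => k k0 /h [] // ke.
    by move: k0; rewrite ke -e.
  by move: k0; rewrite ke -e.
have [s|s] := leP 0 (t k'); [left|right] => k k0.
  by have [->//|tk] := eqVneq (t k) 0; rewrite (hk' k k0 tk).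
by have [->//|tk] := eqVneq (t k) 0; rewrite (hk' k k0 tk) ltW.
Qed.

Theorem theorem4 (R : realType) (n : nat) (D : set 'rV[R]_n.+1) (alpha : R)
  (a : 'rV[R]_n.+1 -> 'M[R]_n.+1) (b : 'rV[R]_n.+1 -> 'rV[R]_n.+1)
  (Q : 'rV[R]_n.+1 -> R) (murev nu : probability (euc R n.+1) R)
  (lam : nat -> R) (phi : nat -> 'rV[R]_n.+1 -> R)
  (halpha : 0 < alpha <= 1)
  (hD : bounded_domain D)
  (hab : elliptic_coefficients alpha a b)
  (hgeom : C2_boundary alpha D \/ product_structure alpha D a b)
  (hQ : drift_potential D a b Q)
  (hmu : reversible_measure D Q murev)
  (hphi : dirichlet_eigenbasis a b D murev lam phi)
  (hnu : nu D = 1%E) :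
  let F k := (\int[murev]_(x in D) phi k x)%R in
  let G k := (\int[nu]_(x in D) phi k x)%R in
  L2_density D murev nu \/
  ((exists S : 'rV[R]_n.+1 -> R,
      {uniform D, (fun N x => \sum_(0 <= k < N) F k / lam k * phi k x) @ \oo --> S}) /\
   forall x, D x -> cvgn (series (fun k => `|F k / lam k * phi k x|))) ->
  ((forall k, (1 <= k)%N -> 0 <= F k * G k) \/
   (forall k, (1 <= k)%N -> F k * G k <= 0)) \/
  (exists k1 k2 : nat, forall k, F k * G k != 0 -> k = k1 \/ k = k2) ->
  forall z : R[i], jump_eigenvalue a b D nu z -> complex.Im z = 0.
Proof.
move=> F G hconv hsign z [f [[Cp Cq fB] [w cw fw] fE]].
case: z fE => x y fE /=; apply/eqP; apply: contrapT => /negP y0.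
have [oD _ _ bD] := hD.
have eig := eigen_Re_Im fE; have bnd := boundary_Re_Im fB.
set p := fun v => complex.Re (f v) in Cp eig bnd.
set q := fun v => complex.Im (f v) in Cq eig bnd.
(* [g + i h] is the eigenfunction minus its boundary value [c1 + i c2]. *)
pose c1 := (\int[nu]_(u in D) p u)%R; pose c2 := (\int[nu]_(u in D) q u)%R.
pose g v := p v - c1; pose h v := q v - c2.
have hg : dirichlet_C2 D g := dirichlet_C2_shift oD bD Cp (fun v Bv => (bnd v Bv).1).
have hh : dirichlet_C2 D h := dirichlet_C2_shift oD bD Cq (fun v Bv => (bnd v Bv).2).
have bg := dirichlet_C2_bcont hg; have bh := dirichlet_C2_bcont hh.
have bphi k := bcont_phi hD hphi k.
(* [e1 + i e2] is the eigenvalue times the boundary value. *)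
pose e1 := x * c1 - y * c2; pose e2 := x * c2 + y * c1.
pose gk k := inner D murev g (phi k); pose hk k := inner D murev h (phi k).
have eq1 k : (lam k - x) * gk k + y * hk k = e1 * F k.
  have := coef_opL hD hab hQ hmu hphi k hg.
  have -> : inner D murev (opL a b g) (phi k) =
      inner D murev (fun v => x * g v + - y * h v + e1) (phi k).
    apply: eq_Rintegral => v /[!inE] Dv; congr (_ * _).
    rewrite /g opL_shift (eig v Dv).1 /e1 /h; ring.
  rewrite (inner_combination murev x (- y) e1 oD bg bh (bphi k))
    -/(gk k) -/(hk k) -/(F k) => E.
  by rewrite mulrBl -E; ring.
have eq2 k : (lam k - x) * hk k - y * gk k = e2 * F k.
  have := coef_opL hD hab hQ hmu hphi k hh.
  have -> : inner D murev (opL a b h) (phi k) =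
      inner D murev (fun v => y * g v + x * h v + e2) (phi k).
    apply: eq_Rintegral => v /[!inE] Dv; congr (_ * _).
    rewrite /h opL_shift (eig v Dv).2 /e2 /g; ring.
  rewrite (inner_combination murev y x e2 oD bg bh (bphi k))
    -/(gk k) -/(hk k) -/(F k) => E.
  by rewrite mulrBl -E; ring.
have den0 k := lt0r_neq0 (resolvent_den_gt0 x y0 (lam k)).
have gkE k : gk k = ((lam k - x) * e1 - y * e2) * F k /
    ((lam k - x) ^+ 2 + y ^+ 2).
  apply: (mulIf (den0 k)); rewrite divfK//.
  transitivity ((lam k - x) * (e1 * F k) - y * (e2 * F k)); last by ring.
  by rewrite -eq1 -eq2; ring.
have hkE k : hk k = ((lam k - x) * e2 + y * e1) * F k /
    ((lam k - x) ^+ 2 + y ^+ 2).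
  apply: (mulIf (den0 k)); rewrite divfK//.
  transitivity ((lam k - x) * (e2 * F k) + y * (e1 * F k)); last by ring.
  by rewrite -eq1 -eq2; ring.
(* If the boundary value is zero, then all the Fourier coefficients are zero, so
   that [f] vanishes. *)
have [E0|E0] := eqVneq (e1 ^+ 2 + e2 ^+ 2) 0.
  move/eqP: E0; rewrite paddr_eq0 ?sqr_ge0// !sqrf_eq0 => /andP[/eqP z1 /eqP z2].
  have r0 : x ^+ 2 + y ^+ 2 != 0.
    by rewrite gt_eqF// ltr_wpDl ?sqr_ge0// exprn_even_gt0.
  have c10 : c1 = 0.
    apply: (mulfI r0); rewrite mulr0.
    by transitivity (x * e1 + y * e2); [rewrite /e1 /e2; ring|rewrite z1 z2; ring].
  have c20 : c2 = 0.
    apply: (mulfI r0); rewrite mulr0.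
    by transitivity (x * e2 - y * e1); [rewrite /e1 /e2; ring|rewrite z1 z2; ring].
  have g0 v : D v -> g v = 0.
    apply: (zero_coefs_eq0 hD hQ hmu hphi bg) => k.
    by rewrite -/(gk k) gkE z1 z2 !mulr0 subrr !mul0r.
  have h0 v : D v -> h v = 0.
    apply: (zero_coefs_eq0 hD hQ hmu hphi bh) => k.
    by rewrite -/(hk k) hkE z1 z2 !mulr0 addr0 !mul0r.
  have pq : p w = 0 /\ q w = 0.
    have [Dw|nDw] := pselect (D w).
      have := g0 w Dw; have := h0 w Dw.
      by rewrite /g /h c10 c20 !subr0.
    have Bw : boundary D w.
      by split => //; rewrite (iffLR (interior_id D) oD).
    by have [pw qw] := bnd w Bw; split; [exact: etrans pw c10|exact: etrans qw c20].
  move/negP: fw; apply; apply/eqP.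
  move: pq; rewrite /p /q; case: (f w) => u v /= [-> ->].
  by [].
have Epos : 0 < e1 ^+ 2 + e2 ^+ 2 by rewrite lt_neqAle eq_sym E0 addr_ge0 ?sqr_ge0.
set E := e1 ^+ 2 + e2 ^+ 2 in E0 Epos.
have hconv' : L2_density D murev nu \/ (exists S : 'rV[R]_n.+1 -> R,
    {uniform D, (fun N x => \sum_(0 <= k < N) F k / lam k * phi k x) @ \oo --> S}).
  by case: hconv => [|[]]; [left|right].
have mean0 s c : bcont D s -> c = (\int[nu]_(v in D) s v)%R ->
    (\int[nu]_(v in D) (s v - c))%R = 0.
  move=> bs ->; rewrite (RintegralB_bcont nu oD bs (bcont_cst D _)).
  have nu1 : fine (nu (D : set (euc R n.+1))) = 1 by rewrite [X in fine X]hnu.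
  by rewrite (Rintegral_bcont_cst nu oD) [X in _ * X]nu1 mulr1 subrr.
have bp : bcont D p by have [[]] := C_closure_C2b oD bD Cp.
have bq : bcont D q by have [[]] := C_closure_C2b oD bD Cq.
have nug : (\int[nu]_(v in D) g v)%R = 0 by exact: mean0.
have nuh : (\int[nu]_(v in D) h v)%R = 0 by exact: mean0.
have comb c d : let P v := c * g v + d * h v + 0 in
    bcont D P /\ (\int[nu]_(v in D) P v)%R = 0.
  have bcg := bcontZ c bg; have bdh := bcontZ d bh.
  have b0 := bcontD bcg bdh; split; first exact: bcontD b0 (bcont_cst D 0).
  transitivity (\int[nu]_(v in D) (c * g v + d * h v))%R.
    by apply: eq_Rintegral => v _; rewrite addr0.
  rewrite (RintegralD_bcont nu oD bcg bdh).
  rewrite (RintegralZ_bcont nu oD _ bg) (RintegralZ_bcont nu oD _ bh).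
  by rewrite nug nuh !mulr0 addr0.
(* Multiplied by [e1 - i e2], the coefficients of [g + i h] become
   [E F k / (lam k - z)], and the integral of [g + i h] against [nu] is zero. *)
have series c d res :
    (forall k, c * gk k + d * hk k = E * (F k * res (lam k))) ->
    (res = resolvent_re x y \/ res = resolvent_im x y) ->
    (fun N => \sum_(0 <= k < N) E * (F k * G k) * res (lam k)) @ \oo --> (0 : R).
  move=> cdE hres; have [bP nuP] := comb c d.
  have inP k : inner D murev (fun v => c * g v + d * h v + 0) (phi k) =
      E * (F k * res (lam k)).
    by rewrite (inner_combination murev c d 0 oD bg bh (bphi k)) mul0r addr0 cdE.
  have := resolvent_series_cvg hD hab hQ hmu hphi hnu (x := x) y0 bP hconv'.
  have -> : (fun N => \sum_(0 <= k < N) E * (F k * G k) * res (lam k)) =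
    (fun N => \sum_(0 <= k < N)
       inner D murev (fun v => c * g v + d * h v + 0) (phi k) * G k).
    by apply/funext => N; apply: eq_bigr => k _; rewrite inP; ring.
  rewrite nuP => lim.
  apply: lim; exists E; split; first exact: ltW.
  by case: hres inP => -> inP; [left|right].
have cre := @series e1 e2 (resolvent_re x y) _ (or_introl erefl).
have cim := @series (- e2) e1 (resolvent_im x y) _ (or_intror erefl).
have F0 : 0 < F 0%N by apply: (gt0_Rintegral_phi0 hD hphi); exact: (mu_D oD hmu).
have G0 : 0 < G 0%N by exact: (gt0_Rintegral_phi0 hD hphi hnu).
have t0 : 0 < F 0%N * G 0%N by exact: mulr_gt0.
have sgn := two_terms_one_sign (lt0r_neq0 t0) hsign.
apply: (@one_sign_contradiction R x y lam (fun k => E * (F k * G k)) y0).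
- by move=> k k1; exact: (lam_lt_lam0 hD hab hQ hmu hphi k1).
- exact: mulr_gt0.
- case: sgn => sgn; [left|right] => k k1.
    by rewrite mulr_ge0 ?(ltW Epos)// sgn.
  by rewrite mulr_ge0_le0 ?(ltW Epos)// sgn.
- by apply: cre => k; rewrite gkE hkE /resolvent_re /E; field; exact: den0.
- by apply: cim => k; rewrite gkE hkE /resolvent_im /E; field; exact: den0.
Qed.
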